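(* Let $f:\mathbb{R}^2\to\mathbb{R}$ be a Gaussian field satisfying the basic assumption, the non-degenerate gradient condition and the monotonicity condition (all defined in the context). For any $t_1,\dots,t_n\in\mathbb{R}^2$ and $u_1,\dots,u_n\in\mathbb{R}$, $$\mathbb{P}\left(\tilde f_\ell(t_i)-\ell\le u_i\ \ \forall i=1,\dots,n\,\middle|\,g,\theta\right)$$ is non-decreasing in $\ell\in\mathbb{R}$ (for any given realisation of $(g,\theta)$).
   Context: Basic assumption: $f:\mathbb{R}^2\to\mathbb{R}$ is a continuous, stationary, centred Gaussian field with $\mathrm{Var}(f(0))=1$ and covariance function $K(x)=\mathbb{E}(f(x)f(0))$ such that (i) $K\in C^{4+\eta'}$ for some $\eta'>0$; (ii) $\nabla^2 f(0)$, viewed as the three-dimensional vector $(\partial_{11}f(0),\partial_{22}f(0),\partial_{12}f(0))$, is a non-degenerate Gaussian vector (invertible covariance matrix); (iii) for any $x\in\mathbb{R}^2$, if $f(x)-f(0)$ is a non-degenerate Gaussian variable then the Gaussian vector $(\nabla f(x),\nabla f(0),f(x)-f(0))$ is non-degenerate. Non-degenerate gradient condition: for all $t\in\mathbb{R}^2\setminus\{0\}$ the conditional covariance matrix $\mathrm{Cov}\big((f(t),\nabla f(t))\,\big|\,f(0),\nabla f(0),\nabla^2 f(0)\big)$ has non-zero determinant. Monotonicity condition: $f$ is isotropic (law invariant under rotations), so $K(x)=k(|x|^2)$, and $\chi:=-k'(0)/\sqrt{k''(0)}\ge1$; the Gaussian vector $(f(0),\nabla^2 f(0))$ is non-degenerate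 (so $\chi<\sqrt2$); and for all $x\in\mathbb{R}^2$, $$\mathbb{E}\left(f(x)\,\middle|\,f(0)=0,\nabla^2 f(0)=\begin{pmatrix}1&0\\0&0\end{pmatrix}\right)\ge0,\qquad \mathbb{E}\left(f(x)\,\middle|\,f(0)=1,\nabla^2 f(0)=\begin{pmatrix}0&0\\0&0\end{pmatrix}\right)\le1.$$ Conditioned field: $\tilde f_\ell$ denotes $f$ conditioned to have a saddle point at the origin at level $\ell$ (the limit as $\epsilon\to0$ of the Palm distribution of $f$ relative to the saddle points of $f$ with level in $[\ell,\ell+\epsilon]$). It is realised through the representation $$\tilde f_\ell(t)=g(t)+\ell\alpha(t)+\lambda_1b_1(t,\theta)+\lambda_2b_2(t,\theta).$$ Here $\alpha:\mathbb{R}^2\to\mathbb{R}$ and $\beta=(\beta_{11},\beta_{22},\beta_{12}):\mathbb{R}^2\to\mathbb{R}^3$ are the unique functions with $\mathbb{E}(f(t)\,|\,f(0)=u,\nabla^2 f(0)=U)=\alpha(t)u+\beta(t)\cdot U$ for all $u\in\mathbb{R}$, $U=(U_{11},U_{22},U_{12})\in\mathbb{R}^3$; $$b_1(t,\theta)=\cos^2(\theta)\beta_{11}(t)+\sin^2(\theta)\beta_{22}(t)+\sin(\theta)\cos(\theta)\beta_{12}(t),$$ $$b_2(t,\theta)=\sin^2(\theta)\beta_{11}(t)+\cos^2(\theta)\beta_{22}(t)-\sin(\theta)\cos(\theta)\beta_{12}(t);$$ $g$ is a centred Gaussian field with covariance $\gamma(s,t)=\mathbb{E}(f(s)f(t)\,|\,f(0)=0,\nabla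 f(0)=0,\nabla^2f(0)=0)$; $\theta$ is uniform on $[0,2\pi)$; $(\lambda_1,\lambda_2)$ has density proportional to $$q_\ell(x,y)=|x|\,y\,(y-x)\,\mathbf{1}_{y>0>x}\exp\left(-\frac{1}{2\sigma^2}\left((x-\mu\ell)^2+(y-\mu\ell)^2+2\tau(x-\mu\ell)(y-\mu\ell)\right)\right)$$ with $\mu=2k'(0)$, $\sigma^2=\frac{16k''(0)(2-\chi^2)}{3-\chi^2}$, $\tau=\frac{\chi^2-1}{3-\chi^2}$; and $g$, $\theta$, $(\lambda_1,\lambda_2)$ are mutually independent. *)

(* Defs.v *)
From HB Require Import structures.
From mathcomp Require Import all_boot all_order all_algebra.
From mathcomp Require Import all_classical all_reals all_analysis.

Set Implicit Arguments.
Unset Strict Implicit.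
Unset Printing Implicit Defensive.

Import Order.TTheory GRing.Theory Num.Theory.
Import numFieldNormedType.Exports.

Local Open Scope classical_set_scope.
Local Open Scope ring_scope.

Section plane.
Context {R : realType}.
Implicit Types (h : R * R -> R) (x : R * R).

Definition vec (n : nat) (s : seq R) : 'rV[R]_n := \row_i s`_i.

Definition dotv n (u v : 'rV[R]_n) : R := \sum_i u 0 i * v 0 i.

Definition normsq x : R := x.1 ^+ 2 + x.2 ^+ 2.

Definition rot (phi : R) x : R * R :=
  (cos phi * x.1 - sin phi * x.2, sin phi * x.1 + cos phi * x.2).

Definition e1 : R * R := (1, 0).
Definition e2 : R * R := (0, 1).

Definition d1 h : R * R -> R := fun x => 'D_e1 h x.
Definition d2 h : R * R -> R := fun x => 'D_e2 h x.

(* [Cpartial n Q h]: all partial derivatives of h up to order n exist, and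
   those of order n satisfy Q. *)
Fixpoint Cpartial (n : nat) (Q : (R * R -> R) -> Prop) h : Prop :=
  if n is m.+1 then
    [/\ forall x, derivable h x e1, forall x, derivable h x e2,
        Cpartial m Q (d1 h) & Cpartial m Q (d2 h)]
  else Q h.

Definition locally_holder (eta : R) h : Prop :=
  forall M : R, exists C : R, forall x y : R * R,
    `|x| <= M -> `|y| <= M -> `|h x - h y| <= C * `|x - y| `^ eta.

(* Lower-order partial derivatives are then continuous as well, since their
   own partial derivatives are. *)
Definition C2 h : Prop := Cpartial 2 (fun g => continuous g) h.
Definition C4holder (eta : R) h : Prop := Cpartial 4 (locally_holder eta) h.

(* Derivative from the right: k is only meaningful on [0, +oo[, where it is
   C^2 (one-sidedly at 0), so this is its derivative there. *)
Definition rderiv (k : R -> R) (r : R) : R :=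
  lim ((fun s => (k (r + s) - k r) / s) @ 0^'+).

Definition k1 (k : R -> R) : R := rderiv k 0.
Definition k2 (k : R -> R) : R := rderiv (rderiv k) 0.

Definition chi (k : R -> R) : R := - k1 k / Num.sqrt (k2 k).

End plane.

Section random.
Context {R : realType} {d : measure_display} {Omega : measurableType d}.
Variable P : probability Omega R.
Implicit Types X : Omega -> R.

Definition gaussian_rv X : Prop := exists m s : R,
  if s == 0 then {ae P, forall w, X w = m}
  else forall B : set R, measurable B -> P (X @^-1` B) = normal_prob m s B.

Definition gaussian_field (f : R * R -> {RV P >-> R}) : Prop :=
  forall (n : nat) (t : 'I_n -> R * R) (a : 'I_n -> R),
    gaussian_rv (fun w => \sum_(i < n) a i * f (t i) w).

Definition centred_field (f : R * R -> {RV P >-> R}) : Prop :=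
  forall x, ('E_P[f x] = 0)%E.

Definition same_law (f h : R * R -> {RV P >-> R}) : Prop :=
  forall (n : nat) (t : 'I_n -> R * R) (B : set (n.-tuple R)), measurable B ->
    P [set w | B [tuple f (t i) w | i < n]] =
    P [set w | B [tuple h (t i) w | i < n]].

Definition stationary (f : R * R -> {RV P >-> R}) : Prop :=
  forall a : R * R, same_law (fun x => f (x + a)) f.

Definition isotropic (f : R * R -> {RV P >-> R}) : Prop :=
  forall phi : R, same_law (fun x => f (rot phi x)) f.

Definition covmx n (X : Omega -> 'rV[R]_n) : 'M[R]_n :=
  \matrix_(i, j) fine (covariance P (fun w => X w 0 i) (fun w => X w 0 j)).

Definition nondegenerate n (X : Omega -> 'rV[R]_n) : Prop :=
  covmx X \in unitmx.

Definition sigma_of (I : Type) (X : I -> Omega -> R) : set_system Omega :=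
  <<s \bigcup_i preimage_set_system setT (X i) measurable >>.

(* [is_cond_mean X Y m]: m is a continuous version of y |-> E(X | Y = y).
   For A = setT the identity also forces m (Y) to be integrable when X is. *)
Definition is_cond_mean n X (Y : Omega -> 'rV[R]_n) (m : 'rV[R]_n -> R) :=
  continuous m /\
  forall A, sigma_of (fun i w => Y w 0 i) A ->
    (\int[P]_(w in A) (X w)%:E = \int[P]_(w in A) (m (Y w))%:E)%E.

(* Conditional covariance matrix of X given Y, which for jointly Gaussian
   vectors is deterministic. *)
Definition is_cond_cov r n (X : Omega -> 'rV[R]_r) (Y : Omega -> 'rV[R]_n)
    (C : 'M[R]_r) : Prop :=
  exists m : 'I_r -> 'rV[R]_n -> R,
    (forall i, is_cond_mean (fun w => X w 0 i) Y (m i)) /\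
    (forall i j, is_cond_mean
       (fun w => (X w 0 i - m i (Y w)) * (X w 0 j - m j (Y w))) Y
       (fun=> C i j)).

(* p is a version of the conditional probability of E given the
   sigma-algebra S. *)
Definition is_cond_prob (S : set_system Omega) (E : set Omega)
    (p : Omega -> R) : Prop :=
  (forall B : set R, measurable B -> S (p @^-1` B)) /\
  (forall A, S A -> (\int[P]_(w in A) (p w)%:E)%E = P (E `&` A)).

Definition independent3 (S1 S2 S3 : set_system Omega) : Prop :=
  forall A B C, S1 A -> S2 B -> S3 C ->
    P (A `&` B `&` C) = (P A * P B * P C)%E.

End random.

Section field.
Context {R : realType} {d : measure_display} {Omega : measurableType d}.
Variable P : probability Omega R.
Variable f : R * R -> {RV P >-> R}.

Definition sample (w : Omega) : R * R -> R := fun x => f x w.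

Definition K (x : R * R) : R := fine 'E_P[fun w => f x w * f 0 w].

Definition f1 (x : R * R) (w : Omega) : R := d1 (sample w) x.
Definition f2 (x : R * R) (w : Omega) : R := d2 (sample w) x.
Definition f11 (x : R * R) (w : Omega) : R := d1 (d1 (sample w)) x.
Definition f22 (x : R * R) (w : Omega) : R := d2 (d2 (sample w)) x.
Definition f12 (x : R * R) (w : Omega) : R := d1 (d2 (sample w)) x.

Definition hess0 (w : Omega) := vec 3 [:: f11 0 w; f22 0 w; f12 0 w].
Definition level_hess0 (w : Omega) :=
  vec 4 [:: f 0 w; f11 0 w; f22 0 w; f12 0 w].
Definition jet0 (w : Omega) :=
  vec 6 [:: f 0 w; f1 0 w; f2 0 w; f11 0 w; f22 0 w; f12 0 w].

Record basic_assumption : Prop := BasicAssumption {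
  basic_gaussian : gaussian_field f;
  basic_continuous : {ae P, forall w, continuous (sample w)};
  (* Consequence of basic_continuous and basic_K (Kolmogorov's criterion),
     needed for the pathwise derivatives f1, ..., f12 to be meaningful. *)
  basic_C2 : {ae P, forall w, C2 (sample w)};
  basic_stationary : stationary f;
  basic_centred : centred_field f;
  basic_var : ('V_P[f 0%R] = 1)%E;
  (* For a larger exponent, K is also C^(4 + eta) for every eta in ]0, 1[. *)
  basic_K : exists eta : R, 0 < eta < 1 /\ C4holder eta K;
  basic_hess : nondegenerate P hess0;
  basic_increment : forall x : R * R,
    nondegenerate P (fun w => vec 1 [:: f x w - f 0 w]) ->
    nondegenerate P
      (fun w => vec 5 [:: f1 x w; f2 x w; f1 0 w; f2 0 w; f x w - f 0 w]) }.

Definition nondegenerate_gradient : Prop :=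
  forall t : R * R, t != 0 ->
    exists C, is_cond_cov P (fun w => vec 3 [:: f t w; f1 t w; f2 t w]) jet0 C /\
      \det C != 0.

(* level_hess0 being a nondegenerate Gaussian vector, its law has full support
   and the continuous version m of the conditional mean is unique. *)
Record monotonicity (k : R -> R) : Prop := Monotonicity {
  mono_isotropic : isotropic f;
  mono_radial : forall x, K x = k (normsq x);
  mono_chi : 1 <= chi k;
  mono_nondegenerate : nondegenerate P level_hess0;
  mono_hess : forall x m, is_cond_mean P (f x) level_hess0 m ->
    0 <= m (vec 4 [:: 0; 1; 0; 0]);
  mono_level : forall x m, is_cond_mean P (f x) level_hess0 m ->
    m (vec 4 [:: 1; 0; 0; 0]) <= 1 }.

Definition cond_mean_coefs (alpha b11 b22 b12 : R * R -> R) : Prop :=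
  forall t, is_cond_mean P (f t) level_hess0
    (dotv (vec 4 [:: alpha t; b11 t; b22 t; b12 t])).

End field.

Section conditioned_field.
Context {R : realType}.

Section density.
Variable k : R -> R.

Definition mu : R := 2 * k1 k.
Definition sigma2 : R := 16 * k2 k * (2 - chi k ^+ 2) / (3 - chi k ^+ 2).
Definition tau : R := (chi k ^+ 2 - 1) / (3 - chi k ^+ 2).

Definition q (l x y : R) : R :=
  if (0 < y) && (x < 0) then
    `|x| * y * (y - x) *
    expR (- (2 * sigma2)^-1 *
      ((x - mu * l) ^+ 2 + (y - mu * l) ^+ 2
       + 2 * tau * (x - mu * l) * (y - mu * l)))
  else 0.

End density.

Section representation.
Variables alpha b11 b22 b12 : R * R -> R.

Definition b1 (t : R * R) (theta : R) : R :=
  cos theta ^+ 2 * b11 t + sin theta ^+ 2 * b22 t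
  + sin theta * cos theta * b12 t.

Definition b2 (t : R * R) (theta : R) : R :=
  sin theta ^+ 2 * b11 t + cos theta ^+ 2 * b22 t
  - sin theta * cos theta * b12 t.

(* Value at t of the field conditioned to have a saddle point at the origin at
   level l, as a function of the realisations of g, theta, lambda1, lambda2. *)
Definition ftilde (l : R) (g : R * R -> R) (theta x y : R) (t : R * R) : R :=
  g t + l * alpha t + x * b1 t theta + y * b2 t theta.

End representation.

Lemma twopi_gt0 : 0 < 2 * pi :> R.
Proof. by rewrite mulr_gt0 // pi_gt0. Qed.

Context {d d' : measure_display} {Omega : measurableType d}.
Context {Omega' : measurableType d'}.
Variables (P : probability Omega R) (P' : probability Omega' R).

(* lam1 l, lam2 l are the variables lambda1, lambda2 for the level l. *)
Record saddle_representation (f : R * R -> {RV P >-> R}) (k : R -> R)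
    (g : R * R -> {RV P' >-> R}) (theta : {RV P' >-> R})
    (lam1 lam2 : R -> {RV P' >-> R}) : Prop := SaddleRepresentation {
  rep_gaussian : gaussian_field g;
  rep_centred : centred_field g;
  rep_cov : forall s t, exists2 m,
    is_cond_mean P (fun w => f s w * f t w) (jet0 f) m &
    covariance P' (g s) (g t) = (m 0)%:E;
  (* The endpoint 2 * pi has probability 0. *)
  rep_theta : forall B : set R, measurable B ->
    P' (theta @^-1` B) = uniform_prob twopi_gt0 B;
  rep_lambda : forall l, exists c : R, forall B : set (R * R), measurable B ->
    P' [set w | B (lam1 l w, lam2 l w)] =
    (c%:E * \int[lebesgue_measure \x lebesgue_measure]_(z in B)
              (q k l z.1 z.2)%:E)%E;
  rep_indep : forall l, independent3 P' (sigma_of g)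
    (sigma_of (fun _ : unit => theta))
    (preimage_set_system setT (fun w => (lam1 l w, lam2 l w)) measurable) }.

End conditioned_field.

(* Main.v *)
Require Import Defs.
From HB Require Import structures.
From mathcomp Require Import all_boot all_order all_algebra.
From mathcomp Require Import all_classical all_reals all_analysis.
From mathcomp Require Import measurable_realfun ring lra.

Set Implicit Arguments.
Unset Strict Implicit.
Unset Printing Implicit Defensive.

Import Order.TTheory GRing.Theory Num.Theory.
Import numFieldNormedType.Exports.

Local Open Scope classical_set_scope.
Local Open Scope ring_scope.

(** Fix g and theta, and write x < 0 < y for the two eigenvalues. The constraints
    on the field are that g(t_i) + l (alpha(t_i) - 1) + x b1 + y b2 <= u_i for
    every i. There are two ingredients.

    First, the set of pairs (x, y) which satisfy the constraints is a lower set
    and grows with l. It grows because alpha <= 1, one of the two inequalities of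
    the monotonicity condition. It is a lower set because b1 and b2 are
    nonnegative, which is the other inequality transported by isotropy: b1(t, theta) is the
    regression of f(t) when the Hessian matrix is the rank one projection on the
    direction theta, which a rotation turns into the projection on the first axis
    ([b1_ge0]; b2 is b1 at theta + pi / 2). To transport the regression, the law
    of the field and its second derivatives at the origin must be invariant under
    rotations. The finite-dimensional laws are invariant by hypothesis; second
    derivatives are almost sure limits of second-order differences
    ([cvg_diff2], a double mean value theorem, which also gives Schwarz's
    theorem), and equality in law passes to such limits ([eq_law_cvg]). The
    Hessian matrix is only measurable off a null set, which is harmless because
    the integral ignores null sets without any measurability
    ([eq_integral_null], [rotated_cond_mean]).

    Secondly, the law of (x, y) decreases stochastically in l. In the
    coordinates s = x + y and T = - x y > 0 the Jacobian determinant is the factor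
    y - x of the density, the factor |x| y is T, and
      (x - m)^2 + (y - m)^2 + 2 tau (x - m) (y - m)
        = (s - m (1 + tau))^2 + 2 (1 - tau) T + constant,   m = mu l,
    so that s and T are independent, the law of T does not depend on l, and the
    law of s is translated by l mu (1 + tau) ([integral_q_shift]). Since x and y
    are the roots of X^2 - s X - T, both increase with s for fixed T
    ([left_root_le], [right_root_le]); hence [saddle_law_mono], as soon as
    mu (1 + tau) <= 0.

    This last sign is [drift_le0]. Here chi >= 1 forces k'(0) < 0, and
    1 + tau = 2 / (3 - chi^2) is positive because chi^2 <= 2. The bound follows
    from the Cauchy-Schwarz inequality between f(0) and the discrete Laplacian of
    f at 0, as the mesh tends to 0: it reads 16 k'(0)^2 <= 32 k''(0), by a
    Taylor expansion of K(s, 0) = k(s^2) to order four ([taylor_k], [k1_sqr_le]).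

    That the probability computed with g and theta frozen is a version of the
    conditional probability is the usual consequence of the independence of
    (lambda1, lambda2) and (g, theta) ([cond_prob_freeze]). *)

(** * Second-order differences of functions of class C^2 *)

(** The mean value theorem on the segment between 0 and [a], whatever the sign
    of [a]. *)
Lemma MVT_origin (R : realType) (f df : R -> R) (a : R) :
  (forall x : R, is_derive x 1 f (df x)) ->
  exists2 c, `|c| <= `|a| & f a - f 0 = df c * a.
Proof.
move=> fdf.
have cf (A : set R) : {within A, continuous f}.
  apply: continuous_subspaceT => x; apply: differentiable_continuous.
  exact/derivable1_diffP.
have [a0|a0] := leP 0 a.
  have [c ca E] := @MVT_segment R f df 0 a a0 (fun x _ => fdf x) (cf _).
  exists c; last by rewrite E subr0.
  by move: ca; rewrite in_itv/= => /andP[c0 ca]; rewrite !ger0_norm.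
have [c ca E] := @MVT_segment R f df a 0 (ltW a0) (fun x _ => fdf x) (cf _).
exists c.
  move: ca; rewrite in_itv/= => /andP[ca c0].
  by rewrite (ler0_norm c0) ler0_norm ?lerN2// ltW.
by rewrite -opprB E sub0r mulrN opprK.
Qed.

Section C2.
Context {R : realType}.
Implicit Types (h : R * R -> R) (x v w : R * R).

Lemma is_derive_slice1 h x :
  (forall y, derivable h y e1) ->
  forall s : R, is_derive s 1 (fun s => h (x.1 + s, x.2)) (d1 h (x.1 + s, x.2)).
Proof.
move=> dh s.
have H : (fun r : R => r^-1 *: (((fun s => h (x.1 + s, x.2)) \o shift s) (r *: 1) -
   h (x.1 + s, x.2))) =
   (fun r : R => r^-1 *: ((h \o shift (x.1 + s, x.2)) (r *: (e1 : R * R)) -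
     h (x.1 + s, x.2))).
  apply/funext => r /=; congr (_ *: (h _ - _)).
  by rewrite /e1/= /shift/=; congr pair => /=; rewrite ?scaler0 ?add0r// [in LHS]addrCA.
apply: DeriveDef; first by rewrite /derivable H; exact: dh.
by rewrite /derive H.
Qed.

Lemma is_derive_slice2 h x :
  (forall y, derivable h y e2) ->
  forall s : R, is_derive s 1 (fun s => h (x.1, x.2 + s)) (d2 h (x.1, x.2 + s)).
Proof.
move=> dh s.
have H : (fun r : R => r^-1 *: (((fun s => h (x.1, x.2 + s)) \o shift s) (r *: 1) -
   h (x.1, x.2 + s))) =
   (fun r : R => r^-1 *: ((h \o shift (x.1, x.2 + s)) (r *: (e2 : R * R)) -
     h (x.1, x.2 + s))).
  apply/funext => r /=; congr (_ *: (h _ - _)).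
  by rewrite /e2/= /shift/=; congr pair => /=; rewrite ?scaler0 ?add0r// [in LHS]addrCA.
apply: DeriveDef; first by rewrite /derivable H; exact: dh.
by rewrite /derive H.
Qed.

(** The derivative of [h] along [v], as a combination of partial derivatives;
    [is_derive_dird] justifies it when these are continuous. *)
Definition dird v h : R * R -> R := fun x => v.1 * d1 h x + v.2 * d2 h x.

Lemma two_step_increment h x a b :
  (forall y, derivable h y e1) -> (forall y, derivable h y e2) ->
  exists c c' : R, [/\ `|c| <= `|a|, `|c'| <= `|b| &
   h (x.1 + a, x.2 + b) - h x =
   a * d1 h (x.1 + c, x.2 + b) + b * d2 h (x.1, x.2 + c')].
Proof.
move=> dh1 dh2.
have [c ca E] := MVT_origin a (is_derive_slice1 (x.1, x.2 + b) dh1).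
have [c' cb E'] := MVT_origin b (is_derive_slice2 x dh2).
exists c, c'; split => //.
move: E E'; rewrite /= !addr0 -(surjective_pairing x) => E E'.
by rewrite mulrC -E mulrC -E'; ring.
Qed.

(** Continuity on the plane with an explicit radius, coordinate by coordinate. *)
Lemma continuous_ballP h (p : R * R) : h @ p --> h p ->
  forall e : R, 0 < e -> exists2 d : R, 0 < d & forall q : R * R,
    `|p.1 - q.1| < d -> `|p.2 - q.2| < d -> `|h p - h q| < e.
Proof.
move=> /cvgrPdist_lt hp e e0; have [[A B] /= [pA pB] AB] := hp e e0.
have /nbhs_ballP[r /= r0 rA] := pA.
have /nbhs_ballP[r' /= r'0 rB] := pB.
exists (Num.min r r'); first by rewrite lt_min r0.
move=> q; rewrite !lt_min => /andP[q1 _] /andP[_ q2].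
by apply: (AB q); split; [exact: rA|exact: rB].
Qed.

Lemma is_derive_dird h x v (s : R) :
  (forall y, derivable h y e1) -> (forall y, derivable h y e2) ->
  continuous (d1 h) -> continuous (d2 h) ->
  is_derive s 1 (fun s : R => h (x + s *: v)) (dird v h (x + s *: v)).
Proof.
move=> dh1 dh2 c1 c2.
set p : R * R := x + s *: v.
suff H : (fun r : R => r^-1 *: (((fun s => h (x + s *: v)) \o shift s) (r *: 1) - h p))
    @ 0^' --> dird v h p.
  apply: DeriveDef; first by apply/cvg_ex; exists (dird v h p).
  by apply: cvg_lim.
apply/cvgrPdist_lt => e e0.
set M : R := `|v.1| + `|v.2| + 1.
have M0 : 0 < M by rewrite /M ltr_wpDl// addr_ge0.
have e'0 : 0 < e / M by rewrite divr_gt0.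
have [d1' d10 H1] := continuous_ballP (c1 p) e'0.
have [d2' d20 H2] := continuous_ballP (c2 p) e'0.
pose d := Num.min d1' d2'.
have d0 : 0 < d by rewrite /d lt_min d10 d20.
exists (d / M) => /=; first by rewrite divr_gt0.
move=> r /=; rewrite sub0r normrN => rd r0.
have rMd : `|r| * M < d by rewrite -ltr_pdivlMr.
(* Moving first along the second axis and then along the first one keeps both
   evaluation points within |r| * M of p. *)
have [c [c' [ca cb E]]] := two_step_increment p (r * v.1) (r * v.2) dh1 dh2.
have v1M : `|v.1| <= M by rewrite /M -addrA lerDl addr_ge0.
have v2M : `|v.2| <= M by rewrite /M (addrC `|v.1|) -addrA lerDl addr_ge0.
have -> : (r%:A + s) = r + s by rewrite /GRing.scale/= mulr1.
have -> : x + (r + s) *: v = (p.1 + r * v.1, p.2 + r * v.2).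
  by rewrite /p/=; congr pair => /=; rewrite /GRing.scale/=; ring.
rewrite E /dird /GRing.scale/=.
have rv1 : `|r * v.1| < d.
  by apply: le_lt_trans rMd; rewrite normrM ler_wpM2l.
have rv2 : `|r * v.2| < d.
  by apply: le_lt_trans rMd; rewrite normrM ler_wpM2l.
have q1 : `|d1 h p - d1 h (p.1 + c, p.2 + r * v.2)| < e / M.
  apply: H1 => /=.
    rewrite opprD addrA subrr sub0r normrN (le_lt_trans ca)// (lt_le_trans rv1)//.
    by rewrite /d ge_min lexx.
  rewrite opprD addrA subrr sub0r normrN (lt_le_trans rv2)//.
  by rewrite /d ge_min lexx.
have q2 : `|d2 h p - d2 h (p.1, p.2 + c')| < e / M.
  apply: H2 => /=; first by rewrite subrr normr0.
  rewrite opprD addrA subrr sub0r normrN (le_lt_trans cb)// (lt_le_trans rv2)//.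
  by rewrite /d ge_min lexx orbT.
rewrite [X in `|X|](_ : _ = v.1 * (d1 h p - d1 h (p.1 + c, p.2 + r * v.2)) +
   v.2 * (d2 h p - d2 h (p.1, p.2 + c'))); last by field.
rewrite (le_lt_trans (ler_normD _ _))// !normrM.
have eM : e = (`|v.1| + `|v.2| + 1) * (e / M) by rewrite -/M mulrC divfK ?gt_eqF.
have p1 : 0 <= `|v.1| * (e / M - `|d1 h p - d1 h (p.1 + c, p.2 + r * v.2)|).
  by rewrite mulr_ge0// subr_ge0 ltW.
have p2 : 0 <= `|v.2| * (e / M - `|d2 h p - d2 h (p.1, p.2 + c')|).
  by rewrite mulr_ge0// subr_ge0 ltW.
by rewrite [ltRHS]eM; move: p1 p2 e'0; lra.
Qed.

(** The second-order difference of [h] along [v] and [w] at the origin. *)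
Definition diff2 h v w : R := h (v + w) - h v - h w + h 0.

Lemma diff2C h v w : diff2 h v w = diff2 h w v.
Proof. by rewrite /diff2 (addrC v); ring. Qed.

(** The second derivative of [h] at the origin along [v] and [w]. The two mixed
    derivatives are kept apart, since their equality is only deduced below. *)
Definition hess h v w : R :=
  v.1 * w.1 * d1 (d1 h) 0 + v.1 * w.2 * d2 (d1 h) 0
  + v.2 * w.1 * d1 (d2 h) 0 + v.2 * w.2 * d2 (d2 h) 0.

Lemma continuous_partials h :
  (forall y, derivable h y e1) -> (forall y, derivable h y e2) ->
  continuous (d1 h) -> continuous (d2 h) -> continuous h.
Proof.
move=> dh1 dh2 c1 c2 p.
have [r1 r10 H1] := continuous_ballP (c1 p) ltr01.
have [r2 r20 H2] := continuous_ballP (c2 p) ltr01.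
apply/cvgrPdist_lt => e e0.
set M : R := `|d1 h p| + `|d2 h p| + 2.
have M0 : 0 < M by rewrite /M ltr_wpDl// addr_ge0.
pose r := Num.min (Num.min r1 r2) (e / M).
have r0 : 0 < r by rewrite /r !lt_min r10 r20/= divr_gt0.
near=> y.
have [y1 y2] : `|p.1 - y.1| < r /\ `|p.2 - y.2| < r.
  near: y; exists (ball p.1 r, ball p.2 r) => /=; last by move=> y [].
  by split; exact: nbhsx_ballx.
have [c [c' [ca cb E]]] := two_step_increment p (y.1 - p.1) (y.2 - p.2) dh1 dh2.
have E1 : p.1 + (y.1 - p.1) = y.1 by rewrite addrC subrK.
have E2 : p.2 + (y.2 - p.2) = y.2 by rewrite addrC subrK.
move: E; rewrite E1 E2 -(surjective_pairing y) => E.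
rewrite distrC E.
move: y1 y2; rewrite !(distrC p.1) !(distrC p.2) => y1 y2.
have rr1 : r <= r1 by rewrite /r !ge_min lexx.
have rr2 : r <= r2 by rewrite /r !ge_min lexx orbT.
have rr3 : r * M <= e by rewrite -ler_pdivlMr// /r !ge_min lexx orbT.
have q1 : `|d1 h p - d1 h (p.1 + c, y.2)| < 1.
  apply: H1 => /=.
    by rewrite opprD addrA subrr sub0r normrN (le_lt_trans ca)// (lt_le_trans y1).
  by rewrite distrC (lt_le_trans y2).
have q2 : `|d2 h p - d2 h (p.1, p.2 + c')| < 1.
  apply: H2 => /=; first by rewrite subrr normr0.
  by rewrite opprD addrA subrr sub0r normrN (le_lt_trans cb)// (lt_le_trans y2).
have b1 : `|d1 h (p.1 + c, y.2)| <= `|d1 h p| + 1.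
  rewrite -lerBlDl (le_trans (lerB_dist _ _))// distrC ltW//.
have b2 : `|d2 h (p.1, p.2 + c')| <= `|d2 h p| + 1.
  rewrite -lerBlDl (le_trans (lerB_dist _ _))// distrC ltW//.
apply: lt_le_trans rr3.
rewrite (le_lt_trans (ler_normD _ _))// !normrM.
have -> : r * M = r * (`|d1 h p| + 1) + r * (`|d2 h p| + 1) by rewrite /M; ring.
apply: ltr_leD.
  apply: le_lt_trans (ler_wpM2l _ b1) _ => //.
  by rewrite ltr_pM2r// ltr_wpDl.
by apply: ler_pM => //; exact: ltW.
Unshelve. all: by end_near. Qed.

Lemma continuous_dird v h :
  continuous (d1 h) -> continuous (d2 h) -> continuous (dird v h).
Proof.
move=> c1 c2 x; apply: cvgD; apply: cvgM.
- exact: (cvg_cst v.1).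
- exact: (c1 x).
- exact: (cvg_cst v.2).
- exact: (c2 x).
Qed.

Lemma diff2_MVT h v w (r : R) : C2 h ->
  exists s s' : R, [/\ `|s| <= `|r|, `|s'| <= `|r| &
   diff2 h (r *: v) (r *: w) =
   r ^+ 2 * (v.1 * dird w (d1 h) (s *: v + s' *: w)
           + v.2 * dird w (d2 h) (s *: v + s' *: w))].
Proof.
move=> [/= dh1 dh2 [dh11 dh21 c11 c21] [dh12 dh22 c12 c22]].
have cd1 := continuous_partials dh11 dh21 c11 c21.
have cd2 := continuous_partials dh12 dh22 c12 c22.
(* The second-order difference is the increment of phi on [0, r], and the
   derivative of phi at s is the increment on [0, r] of the function psi below. *)
pose phi a := h (r *: w + a *: v) - h (0 + a *: v).
have dphi (a : R) : is_derive a 1 phi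
    (dird v h (r *: w + a *: v) - dird v h (0 + a *: v)).
  exact: (is_deriveB (is_derive_dird (r *: w) v a dh1 dh2 cd1 cd2)
                     (is_derive_dird 0 v a dh1 dh2 cd1 cd2)).
have [s sr Es] := MVT_origin r dphi.
pose psi a := v.1 * d1 h (s *: v + a *: w) + v.2 * d2 h (s *: v + a *: w).
have dpsi (a : R) : is_derive a 1 psi (v.1 * dird w (d1 h) (s *: v + a *: w)
    + v.2 * dird w (d2 h) (s *: v + a *: w)).
  have D1 := is_derive_dird (s *: v) w a dh11 dh21 c11 c21.
  have D2 := is_derive_dird (s *: v) w a dh12 dh22 c12 c22.
  exact: (is_deriveD (is_deriveZ v.1 D1) (is_deriveZ v.2 D2)).
have [s' s'r Es'] := MVT_origin r dpsi.
exists s, s'; split => //.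
move: Es' Es; rewrite /psi /phi /dird !scale0r !addr0 !add0r (addrC (s *: v) (r *: w)).
move=> -> Es; rewrite /diff2 (addrC (r *: v)).
by rewrite expr2 -mulrA (mulrC r) -[X in X * r]mulrC -Es; ring.
Qed.

Lemma cvg_diff2_hess h v w : C2 h ->
  (fun n : nat => n.+1%:R ^+ 2 * diff2 h (n.+1%:R^-1 *: v) (n.+1%:R^-1 *: w))
    @ \oo --> hess h v w.
Proof.
move=> h2; have [/= dh1 dh2 [dh11 dh21 c11 c21] [dh12 dh22 c12 c22]] := h2.
pose H x := v.1 * dird w (d1 h) x + v.2 * dird w (d2 h) x.
have cH : H @ (0 : R * R) --> H 0.
  apply: cvgD; apply: cvgM.
  - exact: (cvg_cst v.1).
  - exact: (@continuous_dird w _ c11 c21 0).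
  - exact: (cvg_cst v.2).
  - exact: (@continuous_dird w _ c12 c22 0).
have -> : hess h v w = H 0.
  rewrite /hess /H /dird.
  move: (d1 (d1 h) 0) (d2 (d1 h) 0) (d1 (d2 h) 0) (d2 (d2 h) 0).
  by move=> a b c d; ring.
have rn (n : nat) : (n.+1%:R : R) != 0 by rewrite pnatr_eq0.
apply/cvgrPdist_lt => e e0.
have [d d0 Hd] := continuous_ballP cH e0.
set M : R := `|v.1| + `|v.2| + `|w.1| + `|w.2| + 1.
have M0 : 0 < M by rewrite /M ltr_wpDl// !addr_ge0.
near=> n.
have [s [s' [sr s'r ->]]] := diff2_MVT v w (n.+1%:R^-1) h2.
rewrite -/(H _) mulrA -exprMn divff// expr1n mul1r.
have nd : n.+1%:R^-1 * M < d.
  rewrite -ltr_pdivlMr//; near: n.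
  have := @cvg_harmonic R => /cvgrPdist_lt /(_ (d / M)).
  rewrite divr_gt0// => /(_ isT); apply: filterS => m /=.
  by rewrite sub0r normrN ger0_norm.
have rE : `|n.+1%:R^-1| = n.+1%:R^-1 :> R by rewrite ger0_norm// invr_ge0.
rewrite {}rE in sr s'r.
have key (a b : R) : `|a| + `|b| <= M -> `|s * a + s' * b| < d.
  move=> ab; apply: le_lt_trans nd.
  apply: le_trans (ler_wpM2l _ ab); rewrite ?invr_ge0//.
  rewrite (le_trans (ler_normD _ _))// mulrDr !normrM lerD// ler_wpM2r//.
apply: Hd; rewrite /= sub0r normrN; apply: key; rewrite /M;
  move: (normr_ge0 v.1) (normr_ge0 v.2) (normr_ge0 w.1) (normr_ge0 w.2); lra.
Unshelve. all: by end_near. Qed.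

(** Schwarz's theorem, from the symmetry of [diff2]. *)
Lemma mixed_partialsC h : C2 h -> d2 (d1 h) 0 = d1 (d2 h) 0.
Proof.
move=> h2.
have E12 : hess h e1 e2 = d2 (d1 h) 0.
  rewrite /hess; move: (d1 (d1 h) 0) (d2 (d1 h) 0) (d1 (d2 h) 0) (d2 (d2 h) 0).
  by move=> a b c d; rewrite /e1 /e2 /=; ring.
have E21 : hess h e2 e1 = d1 (d2 h) 0.
  rewrite /hess; move: (d1 (d1 h) 0) (d2 (d1 h) 0) (d1 (d2 h) 0) (d2 (d2 h) 0).
  by move=> a b c d; rewrite /e1 /e2 /=; ring.
rewrite -E12 -E21.
have H12 := @cvg_diff2_hess h e1 e2 h2.
have := @cvg_diff2_hess h e2 e1 h2.
under eq_fun do rewrite diff2C.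
move=> H21; exact: (cvg_unique (@norm_hausdorff R R) H12 H21).
Qed.

Lemma cvg_diff2 h v w : C2 h ->
  (fun n : nat => n.+1%:R ^+ 2 * diff2 h (n.+1%:R^-1 *: v) (n.+1%:R^-1 *: w))
    @ \oo --> v.1 * w.1 * d1 (d1 h) 0 + (v.1 * w.2 + v.2 * w.1) * d1 (d2 h) 0
     + v.2 * w.2 * d2 (d2 h) 0.
Proof.
move=> h2; have := @cvg_diff2_hess h v w h2.
by rewrite /hess (mixed_partialsC h2) mulrDl addrA.
Qed.

End C2.

(** * Null sets, integrals and equality in law *)

Section integral_facts.
Context {d : measure_display} {T : measurableType d} {R : realType}.
Variable mu : {measure set T -> \bar R}.

Import HBNNSimple.

(** The integral of a nonnegative function, measurable or not, is a supremum over
    the simple functions below it, and these may be cut off on a null set. *)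
Lemma nnintegral_setD_null (N : set T) (f : T -> \bar R) :
  measurable N -> mu N = 0%E -> (forall x, 0 <= f x)%E ->
  ereal_sup [set sintegral mu h | h in
    [set h : {nnsfun T >-> R} | forall x, ((h x)%:E <= f x)%E]] =
  ereal_sup [set sintegral mu h | h in
    [set h : {nnsfun T >-> R} | forall x, ((h x)%:E <= (f \_ (~` N)) x)%E]].
Proof.
move=> mN N0 f0; apply/eqP; rewrite eq_le; apply/andP; split; last first.
  apply: le_ereal_sup => _ [h /= hf <-]; exists h => // x.
  by apply: le_trans (hf x) _; rewrite patchE; case: ifP.
apply: ge_ereal_sup; move=> y /= [h /= hf <-{y}].
pose h' := proj_nnsfun h (measurableC mN).
have -> : sintegral mu h = sintegral mu h'.
  rewrite -!integralT_nnsfun; apply: ae_eq_integral => //;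
    try exact/measurable_EFinP/measurable_funP.
  exists N; split => // x /= /not_implyP[_] hh'; apply: contrapT => Nx.
  by apply: hh'; rewrite mindicE mem_set ?mulr1.
apply: ereal_sup_ubound; exists h' => //= x.
by rewrite mindicE patchE; case: ifP => _; rewrite ?mulr1 ?mulr0.
Qed.

(** The integral ignores a null set even when neither the integrand nor the
    domain is measurable. *)
Lemma integral_setD_null (N D : set T) (f : T -> \bar R) :
  measurable N -> mu N = 0%E ->
  (\int[mu]_(x in D) f x = \int[mu]_(x in D `\` N) f x)%E.
Proof.
move=> mN N0; rewrite /integral !funepos_restrict !funeneg_restrict !setDE.
rewrite (nnintegral_setD_null mN N0) => [|x]; last first.
  by rewrite patchE; case: ifP => // _; exact: funepos_ge0.
rewrite [X in (_ - X)%E](nnintegral_setD_null mN N0) => [|x]; last first.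
  by rewrite patchE; case: ifP => // _; exact: funeneg_ge0.
by rewrite -!patch_setI (setIC (~` N)).
Qed.

Lemma eq_integral_null (N D D' : set T) (f g : T -> \bar R) :
  measurable N -> mu N = 0%E ->
  (forall x, ~ N x -> D x <-> D' x) -> (forall x, ~ N x -> D x -> f x = g x) ->
  (\int[mu]_(x in D) f x = \int[mu]_(x in D') g x)%E.
Proof.
move=> mN N0 DD' fg; rewrite (integral_setD_null D _ mN N0).
rewrite (integral_setD_null D' _ mN N0).
have -> : D' `\` N = D `\` N.
  by apply/seteqP; split => x [Dx Nx]; split => //; apply/DD'.
by apply: eq_integral => x; rewrite inE => -[Dx Nx]; exact: fg.
Qed.

End integral_facts.

Section eq_law.
Context {d : measure_display} {T : measurableType d} {R : realType}.
Context {d' : measure_display} {S : measurableType d'}.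
Variable P : {measure set T -> \bar R}.

(** Two maps with the same law give the same integrals. *)
Lemma eq_law_integral (X Y : T -> S) (psi : S -> \bar R) (B : set S) :
  measurable_fun setT X -> measurable_fun setT Y ->
  (forall A, measurable A -> P (X @^-1` A) = P (Y @^-1` A)) ->
  measurable_fun setT psi -> measurable B ->
  (\int[P]_(w in X @^-1` B) psi (X w) = \int[P]_(w in Y @^-1` B) psi (Y w))%E.
Proof.
move=> mX mY XY mpsi mB.
have ge0 (phi : S -> \bar R) : (forall s, 0 <= phi s)%E -> measurable_fun setT phi ->
    (\int[P]_(w in X @^-1` B) phi (X w) = \int[P]_(w in Y @^-1` B) phi (Y w))%E.
  move=> phi0 mphi.
  have mphiB := measurable_funS measurableT (@subsetT _ B) mphi.
  rewrite -(ge0_integral_pushforward mX)//.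
  rewrite -(ge0_integral_pushforward mY)//.
  by apply: eq_measure_integral => A mA _; exact: XY.
rewrite [LHS]integralE [RHS]integralE.
rewrite -[fun x => psi (X x)]/(psi \o X) -[fun x => psi (Y x)]/(psi \o Y).
rewrite (funepos_comp psi X) (funepos_comp psi Y).
rewrite (funeneg_comp psi X) (funeneg_comp psi Y); congr (_ - _)%E.
  exact: (ge0 (fun s => psi^\+ s)%E (funepos_ge0 psi) (measurable_funepos mpsi)).
exact: (ge0 (fun s => psi^\- s)%E (funeneg_ge0 psi) (measurable_funeneg mpsi)).
Qed.

End eq_law.

Section tuple_orthants.
Context {R : realType} {k : nat}.

(** Open upper orthants in R^k. *)
Definition upper_orthant (a : 'I_k -> R) : set (k.-tuple R) :=
  [set z | forall i, a i < tnth z i].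

(** A generating pi-system, see [measurable_upper_orthants]. *)
Definition upper_orthants : set_system (k.-tuple R) := range upper_orthant.

Lemma measurable_upper_orthant a : measurable (upper_orthant a).
Proof.
have -> : upper_orthant a =
    \bigcap_(i in [set: 'I_k]) ((@tnth _ R)^~ i @^-1` `]a i, +oo[).
  apply/seteqP; split => z /=.
    by move=> za i _; rewrite /= in_itv/= andbT.
  by move=> za i; have := za i I; rewrite /= in_itv/= andbT.
apply: fin_bigcap_measurable => [|i _]; first exact: finite_finset.
by rewrite -[X in measurable X]setTI; exact: measurable_tnth.
Qed.

Lemma upper_orthants_setI : setI_closed upper_orthants.
Proof.
move=> _ _ [a _ <-] [b _ <-]; exists (fun i => Num.max (a i) (b i)) => //.
apply/seteqP; split => z /=.
  by move=> zab; split => i; have := zab i; rewrite gt_max => /andP[].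
by move=> [za zb] i; rewrite gt_max za zb.
Qed.

Lemma upper_orthants_cover : \bigcup_n (upper_orthant (fun=> - n%:R)) = setT.
Proof.
apply/seteqP; split => // z _.
pose M := \sum_(i < k) `|tnth z i|.
have M0 : 0 <= M by exact: sumr_ge0.
exists (Num.truncn M).+1 => //= i.
have : `|tnth z i| <= M.
  by rewrite /M (bigD1 i)//= lerDl; exact: sumr_ge0.
have := truncnS_gt M; rewrite -/M => h1 h2.
have := ler_norm (- tnth z i); rewrite normrN; lra.
Qed.

Lemma measurable_upper_orthants : @measurable _ (k.-tuple R) = <<s upper_orthants >>.
Proof.
apply/seteqP; split; last first.
  apply: smallest_sub; first exact: sigma_algebra_measurable.
  by move=> _ [a _ <-]; exact: measurable_upper_orthant.
pose U := g_sigma_algebraType upper_orthants.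
suff : measurable_fun [set: U] (fun z : U => (z : k.-tuple R)).
  move=> + A mA; move=> /(_ measurableT A mA).
  by rewrite setTI.
apply/measurable_fun_tnthP => i; apply: (measurability _ (RGenOInfty.measurableE R)).
move=> _ [_ [a ->] <-]; rewrite setTI.
rewrite (_ : _ @^-1` _ = \bigcup_n upper_orthant (fun j => if j == i then a else - n%:R)).
  apply: bigcupT_measurable => n; apply: sub_sigma_algebra.
  by exists (fun j => if j == i then a else - n%:R).
apply/seteqP; split => z /=.
  rewrite in_itv/= andbT => zi.
  have : [set: k.-tuple R] z by [].
  rewrite -upper_orthants_cover => -[n _ zn]; exists n => // j /=.
  by case: eqP => [->//|_]; exact: zn.
by move=> [n _ /(_ i)] /=; rewrite eqxx in_itv/= andbT.
Qed.

End tuple_orthants.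

Section law_limit.
Context {d : measure_display} {T : measurableType d} {R : realType}.
Variable P : probability T R.

(** [ramp j] increases with [j] to the indicator function of ]0, +oo[. *)
Definition ramp (j : nat) (x : R) : R := Num.min 1 (Num.max 0 (j%:R * x)).

Lemma ramp_ge0 j x : 0 <= ramp j x.
Proof. by rewrite /ramp le_min ler01/= le_max lexx. Qed.

Lemma ramp_le1 j x : ramp j x <= 1.
Proof. by rewrite /ramp ge_min lexx. Qed.

Lemma continuous_ramp j : continuous (ramp j).
Proof.
move=> x.
have cmax : (fun y : R => Num.max 0 (j%:R * y)) @ x --> Num.max 0 (j%:R * x).
  apply: (@continuous2_cvg R R R R _ _ (cst 0) ( *%R j%:R) Num.max 0 (j%:R * x)).
  - exact: (@max_continuous _ R (0, j%:R * x)).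
  - exact: cvg_cst.
  - exact: mulrl_continuous.
apply: (@continuous2_cvg R R R R _ _ (cst 1) _ Num.min 1 _ _ _ cmax).
- exact: (@min_continuous _ R (1, Num.max 0 (j%:R * x))).
- exact: cvg_cst.
Qed.

Lemma cvg_ramp x : (fun j => ramp j x) @ \oo --> ((0 < x)%R%:R : R).
Proof.
apply: cvg_near_cst; have [x0|x0] := ltP 0 x; last first.
  by near=> j; rewrite /ramp max_l ?mulr_ge0_le0// min_r.
near=> j; rewrite /ramp; apply/min_idPl; rewrite le_max; apply/orP; right.
rewrite -ler_pdivrMr// mul1r.
by near: j; exact: nbhs_infty_ger.
Unshelve. all: by end_near. Qed.

Lemma ramps_bound (I : finType) (j : I -> nat) (x : I -> R) :
  0 <= \prod_i ramp (j i) (x i) <= 1.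
Proof.
rewrite prodr_ge0 => [|i _]; last exact: ramp_ge0.
by rewrite prodr_ile1// => i _; rewrite ramp_ge0 ramp_le1.
Qed.

Lemma cvg_bounded_expectation (X : nat -> T -> R) (Y : T -> R) :
  (forall n, measurable_fun setT (X n)) -> measurable_fun setT Y ->
  (forall n w, 0 <= X n w <= 1) ->
  {ae P, forall w, (fun n => X n w) @ \oo --> Y w} ->
  (fun n => \int[P]_w (X n w)%:E)%E @ \oo --> (\int[P]_w (Y w)%:E)%E.
Proof.
move=> mX mY X01 XY.
have [] // := @dominated_convergence _ _ _ P setT measurableT
  (fun n w => (X n w)%:E) (fun w => (Y w)%:E) (cst 1%E).
- by move=> n; exact/measurable_EFinP.
- exact/measurable_EFinP.
- by apply: filterS XY => w Xw _; apply: cvg_EFin; [exact: nearW|exact: Xw].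
- exact: finite_measure_integrable_cst.
- apply: aeW => w n _ /=; rewrite lee_fin.
  by have /andP[X0 X1] := X01 n w; rewrite ger0_norm.
Qed.

(** Equality in law passes to almost sure limits. *)
Lemma eq_law_cvg k (X X' : nat -> 'I_k -> T -> R) (Y Y' : 'I_k -> T -> R) :
  (forall n i, measurable_fun setT (X n i)) ->
  (forall n i, measurable_fun setT (X' n i)) ->
  (forall i, measurable_fun setT (Y i)) ->
  (forall i, measurable_fun setT (Y' i)) ->
  {ae P, forall w, forall i, (fun n => X n i w) @ \oo --> Y i w} ->
  {ae P, forall w, forall i, (fun n => X' n i w) @ \oo --> Y' i w} ->
  (forall n (B : set (k.-tuple R)), measurable B ->
    P [set w | B [tuple X n i w | i < k]] = P [set w | B [tuple X' n i w | i < k]]) ->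
  forall B : set (k.-tuple R), measurable B ->
    P [set w | B [tuple Y i w | i < k]] = P [set w | B [tuple Y' i w | i < k]].
Proof.
move=> mX mX' mY mY' XY XY' XX'.
have mtup (Z : 'I_k -> T -> R) : (forall i, measurable_fun setT (Z i)) ->
    measurable_fun setT (fun w => [tuple Z i w | i < k]).
  move=> mZ; apply/measurable_fun_tnthP => i.
  by rewrite (_ : _ \o _ = Z i)//; apply/funext => w /=; rewrite tnth_mktuple.
(* For fixed j, psi a j is a bounded continuous test function; it increases with
   j to the indicator function of the orthant. The limit in n is taken first. *)
pose psi (a : 'I_k -> R) (j : nat) (z : 'I_k -> R) := \prod_i ramp j (z i - a i).
have mramp (Z : T -> R) j (a : R) : measurable_fun setT Z ->
    measurable_fun setT (fun w => ramp j (Z w - a)).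
  move=> mZ; apply: (@measurableT_comp _ _ _ _ _ _ (ramp j)).
    by apply: continuous_measurable_fun; exact: continuous_ramp.
  by apply: measurable_funB => //; exact: measurable_cst.
have mpsi a j (Z : 'I_k -> T -> R) : (forall i, measurable_fun setT (Z i)) ->
    measurable_fun setT (fun w => psi a j (Z^~ w)).
  by move=> mZ; apply: measurable_prod => i _; exact: mramp.
have psi01 a j z : 0 <= psi a j z <= 1 by exact: (ramps_bound (fun=> j)).
have lim1 a j (Z : nat -> 'I_k -> T -> R) (W : 'I_k -> T -> R) :
    (forall n i, measurable_fun setT (Z n i)) -> (forall i, measurable_fun setT (W i)) ->
    {ae P, forall w, forall i, (fun n => Z n i w) @ \oo --> W i w} ->
    (fun n => \int[P]_w (psi a j ((Z n)^~ w))%:E)%E @ \oo -->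
    (\int[P]_w (psi a j (W^~ w))%:E)%E.
  move=> mZ mW ZW; apply: cvg_bounded_expectation => //.
  - by move=> n; exact: mpsi.
  - exact: mpsi.
  - apply: filterS ZW => w Zw; rewrite /psi.
    apply: cvg_big => [|i _]; first by move=> x; exact: mul_continuous.
    apply: (@continuous_cvg _ _ _ _ _ _ (ramp j)); first exact: continuous_ramp.
    by apply: cvgB => //; exact: cvg_cst.
have lim2 a (W : 'I_k -> T -> R) : (forall i, measurable_fun setT (W i)) ->
    (fun j => \int[P]_w (psi a j (W^~ w))%:E)%E @ \oo -->
    P [set w | upper_orthant a [tuple W i w | i < k]].
  move=> mW.
  have morthant : measurable [set w | upper_orthant a [tuple W i w | i < k]].
    rewrite -[X in measurable X]setTI.
    by apply: (mtup _ mW) => //; exact: measurable_upper_orthant.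
  rewrite -[X in _ --> P X]setIT -(@integral_indic _ _ _ P setT)//.
  apply: (@cvg_bounded_expectation (fun j w => psi a j (W^~ w))
     (fun w => \1_[set w | upper_orthant a [tuple W i w | i < k]] w)) => //.
  - by move=> j; exact: mpsi.
  - exact: measurable_indic.
  - apply: aeW => w; rewrite /psi indicE.
    have -> : ((w \in [set w | upper_orthant a [tuple W i w | i < k]])%:R : R) =
        \prod_i (0 < W i w - a i)%R%:R.
      case: (boolP (w \in _)).
        rewrite inE /upper_orthant/= => wa; rewrite big1// => i _.
        by have := wa i; rewrite tnth_mktuple subr_gt0 => ->.
      rewrite notin_setE /upper_orthant/= => /existsNP[i /negP].
      rewrite tnth_mktuple => /negbTE ai.
      by rewrite (bigD1 i)//= subr_gt0 ai mul0r.
    apply: cvg_big => [|i _]; first by move=> x; exact: mul_continuous.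
    exact: cvg_ramp.
have E a j n : (\int[P]_w (psi a j ((X n)^~ w))%:E =
    \int[P]_w (psi a j ((X' n)^~ w))%:E)%E.
  pose q (z : k.-tuple R) := (psi a j (tnth z))%:E.
  have mq : measurable_fun setT q.
    apply/measurable_EFinP; apply: measurable_prod => i _.
    apply: (@measurableT_comp _ _ _ _ _ _ (ramp j)).
      by apply: continuous_measurable_fun; exact: continuous_ramp.
    by apply: measurable_funB; [exact: measurable_tnth|exact: measurable_cst].
  have := @eq_law_integral _ _ _ _ _ P _ _ q setT (mtup _ (mX n)) (mtup _ (mX' n))
    (XX' n) mq measurableT.
  rewrite !preimage_setT => EQ.
  have qE (Z : 'I_k -> T -> R) : (\int[P]_w q [tuple Z i w | i < k] =
      \int[P]_w (psi a j (Z^~ w))%:E)%E.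
    apply: eq_integral => w _; congr (psi a j _)%:E.
    by apply/funext => i; rewrite tnth_mktuple.
  by rewrite -(qE (X n)) -(qE (X' n)); exact: EQ.
have Eorthant a : P [set w | upper_orthant a [tuple Y i w | i < k]] =
    P [set w | upper_orthant a [tuple Y' i w | i < k]].
  have L := lim2 a _ mY; have L' := lim2 a _ mY'.
  suff E' j : (\int[P]_w (psi a j (Y^~ w))%:E = \int[P]_w (psi a j (Y'^~ w))%:E)%E.
    rewrite (funext E') in L.
    exact: (cvg_unique (@ereal_hausdorff R) L L').
  have L1 := lim1 a j _ _ mX mY XY; have L2 := lim1 a j _ _ mX' mY' XY'.
  rewrite (funext (E a j)) in L1.
  exact: (cvg_unique (@ereal_hausdorff R) L1 L2).
move=> B mB.
pose m1 : {measure set _ -> \bar R} :=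
  measure_function_pushforward__canonical__measure_function_Measure P (mtup _ mY).
pose m2 : {measure set _ -> \bar R} :=
  measure_function_pushforward__canonical__measure_function_Measure P (mtup _ mY').
apply: (@measure_unique _ R _ upper_orthants
  (fun n => upper_orthant (fun=> - n%:R)) _ _ _ _ m1 m2) => //.
- exact: measurable_upper_orthants.
- exact: upper_orthants_setI.
- by move=> n; exists (fun=> - n%:R).
- exact: upper_orthants_cover.
- by move=> _ [a _ <-]; exact: Eorthant.
- move=> n; apply: (le_lt_trans (probability_le1 _ _)); rewrite ?ltry//.
  rewrite -[X in measurable X]setTI.
  by apply: (mtup _ mY) => //; exact: measurable_upper_orthant.
Qed.

End law_limit.

(** * Rotations of the plane and approximation of the jet of a field *)

Section sigma_tuple.
Context {R : realType} {d : measure_display} {T : measurableType d}.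

(** Events of a finite family are the preimages of Borel sets of R^k; the family
    need not be measurable. *)
Lemma sigma_of_tuple k (X : 'I_k -> T -> R) (A : set T) :
  sigma_of X A <->
  exists2 B : set (k.-tuple R), measurable B & A = [set w | B [tuple X i w | i < k]].
Proof.
pose tX w := [tuple X i w | i < k].
split.
  have sG := sigma_algebra_preimage setT tX (@sigma_algebra_measurable _ (k.-tuple R)).
  rewrite /sigma_of => /(_ _) sA.
  suff [B mB <-] : preimage_set_system setT tX measurable A.
    by exists B => //; rewrite setTI.
  apply: sA; split => //.
  move=> _ [i _ [B mB <-]].
  exists ((@tnth _ R)^~ i @^-1` B).
    by rewrite -[X in measurable X]setTI; exact: measurable_tnth.
  by rewrite !setTI; apply/seteqP; split => w /=; rewrite tnth_mktuple.
move=> [B mB ->].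
pose U := g_sigma_algebraType (\bigcup_i preimage_set_system setT (X i) measurable).
have : measurable_fun [set: U] (tX : U -> k.-tuple R).
  apply/measurable_fun_tnthP => i _ C mC.
  apply: sub_sigma_algebra; exists i => //; exists C => //.
  by rewrite !setTI; apply/seteqP; split => w /=; rewrite tnth_mktuple.
by move=> /(_ measurableT B mB); rewrite setTI.
Qed.

Lemma sigma_of_measurable (I : Type) (X : I -> T -> R) (A : set T) :
  (forall i, measurable_fun setT (X i)) -> sigma_of X A -> measurable A.
Proof.
move=> mX; apply: smallest_sub; first exact: sigma_algebra_measurable.
by move=> _ [i _ [B mB <-]]; exact: mX.
Qed.

End sigma_tuple.

Section rotation.
Context {R : realType}.

Lemma rot_planeZ (phi r : R) (v : R * R) : Defs.rot phi (r *: v) = r *: Defs.rot phi v.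
Proof. by rewrite /Defs.rot /=; congr pair => /=; rewrite /GRing.scale /=; ring. Qed.

Lemma rot_planeD (phi : R) (v w : R * R) :
  Defs.rot phi (v + w) = Defs.rot phi v + Defs.rot phi w.
Proof. by rewrite /Defs.rot /=; congr pair => /=; ring. Qed.

Lemma rot_plane0 (phi : R) : Defs.rot phi (0 : R * R) = 0.
Proof. by rewrite /Defs.rot /=; congr pair => /=; ring. Qed.

Lemma diff2_rot (phi : R) (h : R * R -> R) (v w : R * R) :
  diff2 (fun x => h (Defs.rot phi x)) v w = diff2 h (Defs.rot phi v) (Defs.rot phi w).
Proof. by rewrite /diff2 rot_planeD rot_plane0. Qed.

(** With [c] and [s] the cosine and the sine of an angle, [y0] the value at the
    origin of a function and [y1], [y2], [y3] its second derivatives along the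
    first axis, along the second axis, and mixed: the same data for the function
    composed with the rotation. *)
Definition rot_jet (c s y0 y1 y2 y3 : R) : seq R :=
  [:: y0; c ^+ 2 * y1 + 2 * (c * s) * y3 + s ^+ 2 * y2;
      s ^+ 2 * y1 - 2 * (c * s) * y3 + c ^+ 2 * y2;
      - (c * s) * y1 + (c ^+ 2 - s ^+ 2) * y3 + c * s * y2].

(** The opposite rotation restores the jet. *)
Lemma rot_jetK (c s y0 y1 y2 y3 : R) : c ^+ 2 + s ^+ 2 = 1 ->
  let y := rot_jet c s y0 y1 y2 y3 in
  rot_jet c (- s) y`_0 y`_1 y`_2 y`_3 = [:: y0; y1; y2; y3].
Proof.
move=> cs /=; rewrite /rot_jet.
have cs2 : (c ^+ 2 + s ^+ 2) ^+ 2 = 1 by rewrite cs expr1n.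
congr [:: _; _; _; _].
- by rewrite -[RHS]mul1r -[X in _ = X * _]cs2; ring.
- by rewrite -[RHS]mul1r -[X in _ = X * _]cs2; ring.
- by rewrite -[RHS]mul1r -[X in _ = X * _]cs2; ring.
Qed.

End rotation.

Section approximate_jet.
Context {R : realType} {d : measure_display} {Omega : measurableType d}.
Variable P : probability Omega R.
Variable f : R * R -> {RV P >-> R}.

(** Discrete approximation of the jet of a random function [X], with step
    (n + 1)^-1, together with the value of [X] at [t]. *)
Definition approx_jet (X : R * R -> Omega -> R) (t : R * R) (n : nat)
    (i : 'I_5) (w : Omega) : R :=
  let D v v' := n.+1%:R ^+ 2 *
     diff2 (fun x => X x w) (n.+1%:R^-1 *: v) (n.+1%:R^-1 *: v') in
  nth 0 [:: X t w; X 0 w; D e1 e1; D e2 e2; D e1 e2] i.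

Lemma same_law_approx_jet (X Y : R * R -> {RV P >-> R}) t n (B : set (5.-tuple R)) :
  same_law X Y -> measurable B ->
  P [set w | B [tuple approx_jet X t n i w | i < 5]] =
  P [set w | B [tuple approx_jet Y t n i w | i < 5]].
Proof.
move=> XY mB.
(* Both approximate jets are the same function F of the values at the points p. *)
pose r : R := n.+1%:R^-1.
pose p (j : 'I_7) : R * R := nth 0 [:: t; 0; r *: e1 + r *: e1; r *: e1;
  r *: e2 + r *: e2; r *: e2; r *: e1 + r *: e2] j.
pose Fs (z : 7.-tuple R) : seq R := [:: tnth z (inord 0); tnth z (inord 1);
    n.+1%:R ^+ 2 *
      (tnth z (inord 2) - tnth z (inord 3) - tnth z (inord 3) + tnth z (inord 1));
    n.+1%:R ^+ 2 *
      (tnth z (inord 4) - tnth z (inord 5) - tnth z (inord 5) + tnth z (inord 1));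
    n.+1%:R ^+ 2 *
      (tnth z (inord 6) - tnth z (inord 3) - tnth z (inord 5) + tnth z (inord 1))].
pose F (z : 7.-tuple R) : 5.-tuple R := [tuple nth 0 (Fs z) i | i < 5].
have mF : measurable_fun setT F.
  have mt (j : 'I_7) : measurable_fun setT (fun z : 7.-tuple R => tnth z j).
    exact: measurable_tnth.
  have mc (a b c e : 'I_7) : measurable_fun setT (fun z : 7.-tuple R =>
      n.+1%:R ^+ 2 * (tnth z a - tnth z b - tnth z c + tnth z e) : R).
    apply: measurable_funM; first exact: measurable_cst.
    by apply: measurable_funD => //; apply: measurable_funB => //; apply: measurable_funB.
  apply/measurable_fun_tnthP => i.
  rewrite (_ : _ \o F = fun z => nth 0 (Fs z) i); last first.
    by apply/funext => z /=; rewrite tnth_mktuple.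
  by case: i => [[|[|[|[|[|i]]]]] i5] /=;
    [exact: mt|exact: mt|exact: mc|exact: mc|exact: mc|].
have mFB : measurable (F @^-1` B) by rewrite -[X in measurable X]setTI; exact: mF.
have FE (Z : R * R -> {RV P >-> R}) w :
    F [tuple Z (p j) w | j < 7] = [tuple approx_jet Z t n i w | i < 5].
  apply: eq_from_tnth => i.
  by rewrite /F !tnth_mktuple /Fs !tnth_mktuple /approx_jet /p !inordK.
have := XY 7%N p _ mFB.
rewrite /preimage /=.
under eq_set do rewrite FE.
by under [in X in _ = X -> _]eq_set do rewrite FE.
Qed.

End approximate_jet.

Section rotated_jet.
Context {R : realType} {d : measure_display} {Omega : measurableType d}.
Variable P : probability Omega R.
Variable f : R * R -> {RV P >-> R}.
Hypothesis hf : basic_assumption f.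
Hypothesis iso : isotropic f.
Variable phi : R.
Let c := cos phi.
Let s := sin phi.

(** The entries of [level_hess0 f], as a list. *)
Definition jet (w : Omega) : seq R := [:: f 0 w; f11 f 0 w; f22 f 0 w; f12 f 0 w].

(** The same entries for the rotated field. *)
Definition jetR (w : Omega) : seq R :=
  rot_jet c s (f 0 w) (f11 f 0 w) (f22 f 0 w) (f12 f 0 w).

Let frot x : {RV P >-> R} := f (Defs.rot phi x).

Lemma cvg_approx_jet t w : C2 (sample f w) -> forall i,
  (fun n => approx_jet f t n i w) @ \oo --> nth 0 (f t w :: jet w) i.
Proof.
move=> h2 [[|[|[|[|[|i]]]]] i5] /=; rewrite /approx_jet /=.
- exact: cvg_cst.
- exact: cvg_cst.
- rewrite [X in _ --> X](_ : _ = e1.1 * e1.1 * f11 f 0 w +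
    (e1.1 * e1.2 + e1.2 * e1.1) * f12 f 0 w + e1.2 * e1.2 * f22 f 0 w).
    exact: cvg_diff2.
  by rewrite /e1 /=; ring.
- rewrite [X in _ --> X](_ : _ = e2.1 * e2.1 * f11 f 0 w +
    (e2.1 * e2.2 + e2.2 * e2.1) * f12 f 0 w + e2.2 * e2.2 * f22 f 0 w).
    exact: cvg_diff2.
  by rewrite /e2 /=; ring.
- rewrite [X in _ --> X](_ : _ = e1.1 * e2.1 * f11 f 0 w +
    (e1.1 * e2.2 + e1.2 * e2.1) * f12 f 0 w + e1.2 * e2.2 * f22 f 0 w).
    exact: cvg_diff2.
  by rewrite /e1 /e2 /=; ring.
- by [].
Qed.

Lemma cvg_approx_jetR t w : C2 (sample f w) -> forall i,
  (fun n => approx_jet frot t n i w) @ \oo --> nth 0 (frot t w :: jetR w) i.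
Proof.
move=> h2.
have D v v' : (fun n => n.+1%:R ^+ 2 *
     diff2 (fun x => frot x w) (n.+1%:R^-1 *: v) (n.+1%:R^-1 *: v')) @ \oo -->
    (Defs.rot phi v).1 * (Defs.rot phi v').1 * f11 f 0 w
    + ((Defs.rot phi v).1 * (Defs.rot phi v').2
       + (Defs.rot phi v).2 * (Defs.rot phi v').1) * f12 f 0 w
    + (Defs.rot phi v).2 * (Defs.rot phi v').2 * f22 f 0 w.
  under eq_fun do rewrite (diff2_rot phi (fun x => f x w)) !rot_planeZ.
  exact: cvg_diff2.
move=> [[|[|[|[|[|i]]]]] i5] /=; rewrite /approx_jet /=.
- exact: cvg_cst.
- by rewrite /frot rot_plane0; exact: cvg_cst.
- have := D e1 e1; congr (_ --> _).
  by rewrite /Defs.rot /e1 /= -/c -/s; ring.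
- have := D e2 e2; congr (_ --> _).
  by rewrite /Defs.rot /e2 /= -/c -/s; ring.
- have := D e1 e2; congr (_ --> _).
  by rewrite /Defs.rot /e1 /e2 /= -/c -/s; ring.
- by [].
Qed.

Lemma measurable_approx_jet (X : R * R -> {RV P >-> R}) t n i :
  measurable_fun setT (approx_jet X t n i).
Proof.
have mX x : measurable_fun setT (X x) by exact: measurable_funP.
have mD v v' : measurable_fun setT (fun w : Omega => n.+1%:R ^+ 2 *
    diff2 (fun x => X x w) v v' : R).
  apply: measurable_funM; first exact: measurable_cst.
  by apply: measurable_funD => //; apply: measurable_funB => //; exact: measurable_funB.
by case: i => [[|[|[|[|[|i]]]]] i5] //; rewrite /approx_jet /=.
Qed.

(** By isotropy the field and the rotated field have the same law jointly with
    their jets. The jets are only known to be measurable off a null set [N], on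
    which they are replaced by 0. *)
Lemma jets_eq_law t : exists N : set Omega,
  [/\ measurable N, P N = 0%E,
   forall i : 'I_5,
     measurable_fun setT ((fun w => nth 0 (f t w :: jet w) i) \_ (~` N)),
   forall i : 'I_5,
     measurable_fun setT ((fun w => nth 0 (frot t w :: jetR w) i) \_ (~` N)) &
   forall B : set (5.-tuple R), measurable B ->
     P [set w | B [tuple ((fun w => nth 0 (frot t w :: jetR w) i) \_ (~` N)) w | i < 5]] =
     P [set w | B [tuple ((fun w => nth 0 (f t w :: jet w) i) \_ (~` N)) w | i < 5]]].
Proof.
have [N [mN N0 NC]] := basic_C2 hf.
have C2N w : ~ N w -> C2 (sample f w) by move=> Nw; apply: contrapT => /NC.
have cN (X : nat -> 'I_5 -> Omega -> R) (Y : 'I_5 -> Omega -> R) :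
    (forall w, C2 (sample f w) -> forall i, (fun n => X n i w) @ \oo --> Y i w) ->
    forall w i, (fun n => (X n i \_ (~` N)) w) @ \oo --> (Y i \_ (~` N)) w.
  move=> XY w i; rewrite patchE; case: ifPn => [/[!inE] Nw|Nw].
    under eq_fun do rewrite patchE mem_set//.
    by apply: XY; exact: C2N.
  by under eq_fun do rewrite patchE (negbTE Nw); exact: cvg_cst.
have mA (X : R * R -> {RV P >-> R}) t' n i :
    measurable_fun setT (approx_jet X t' n i \_ (~` N)).
  apply/(measurable_restrictT _ _).1; first exact: measurableC.
  by apply: measurable_funTS; exact: measurable_approx_jet.
have mJ (i : 'I_5) :
    measurable_fun setT ((fun w => nth 0 (f t w :: jet w) i) \_ (~` N)).
  apply: (measurable_fun_cvg (mA f t ^~ i)) => w _.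
  apply: (cN (approx_jet f t) (fun i w => nth 0 (f t w :: jet w) i)).
  exact: cvg_approx_jet.
have mJR (i : 'I_5) :
    measurable_fun setT ((fun w => nth 0 (frot t w :: jetR w) i) \_ (~` N)).
  apply: (measurable_fun_cvg (mA frot t ^~ i)) => w _.
  apply: (cN (approx_jet frot t) (fun i w => nth 0 (frot t w :: jetR w) i)).
  exact: cvg_approx_jetR.
have aeN : {ae P, forall w, ~ N w}.
  by exists N; split => // w /= /contrapT.
exists N; split => //.
apply: (@eq_law_cvg _ _ _ P 5 (approx_jet frot t) (approx_jet f t)) => //.
- exact: measurable_approx_jet.
- exact: measurable_approx_jet.
- apply: filterS aeN => w Nw i; rewrite patchE mem_set//.
  by apply: cvg_approx_jetR; exact: C2N.
- apply: filterS aeN => w Nw i; rewrite patchE mem_set//.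
  by apply: cvg_approx_jet; exact: C2N.
- by move=> n B mB; apply: same_law_approx_jet => //; exact: iso.
Qed.

End rotated_jet.

(** * Positivity of the regression coefficients *)

Section dotv_facts.
Context {R : realType}.

Lemma continuous_dotv n (u : 'rV[R]_n) : continuous (dotv u).
Proof.
move=> y; rewrite /dotv.
apply: (@cvg_big R _ +%R 0 xpredT _ _ (nbhs y)) => [|i _].
  exact: add_continuous.
by apply: cvgM; [exact: (cvg_cst (u 0 i))|exact: coord_continuous].
Qed.

Lemma dotv4 (a b : seq R) :
  dotv (vec 4 a) (vec 4 b) = a`_0 * b`_0 + a`_1 * b`_1 + a`_2 * b`_2 + a`_3 * b`_3.
Proof. by rewrite /dotv !big_ord_recl big_ord0 !mxE /= /bump /= addr0 !addrA. Qed.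

End dotv_facts.

Section rotated_regression.
Context {R : realType} {d : measure_display} {Omega : measurableType d}.
Variable P : probability Omega R.
Variable f : R * R -> {RV P >-> R}.
Hypothesis hf : basic_assumption f.
Hypothesis iso : isotropic f.

(** The regression of the field at a rotated point is the regression at the
    original point, evaluated at the rotated jet. *)
Lemma rotated_cond_mean (alpha b11 b22 b12 : R * R -> R) (phi : R) (t : R * R) :
  cond_mean_coefs f alpha b11 b22 b12 ->
  is_cond_mean P (f (Defs.rot phi t)) (level_hess0 f)
    (dotv (vec 4 [:: alpha t;
       cos phi ^+ 2 * b11 t + sin phi ^+ 2 * b22 t - cos phi * sin phi * b12 t;
       sin phi ^+ 2 * b11 t + cos phi ^+ 2 * b22 t + cos phi * sin phi * b12 t;
       2 * (cos phi * sin phi) * b11 t - 2 * (cos phi * sin phi) * b22 t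
         + (cos phi ^+ 2 - sin phi ^+ 2) * b12 t])).
Proof.
set c := cos phi; set s := sin phi; move=> hab; split; first exact: continuous_dotv.
move=> A /sigma_of_tuple[B mB AE].
have cs1 : c ^+ 2 + s ^+ 2 = 1 by exact: cos2Dsin2.
have YE w : [tuple level_hess0 f w 0 i | i < 4] = [tuple nth 0 (jet f w) i | i < 4].
  by apply: eq_from_tnth => i; rewrite !tnth_mktuple mxE.
pose inv (y : 4.-tuple R) : 4.-tuple R := [tuple nth 0 (rot_jet c (- s)
  (tnth y (inord 0)) (tnth y (inord 1)) (tnth y (inord 2)) (tnth y (inord 3))) i | i < 4].
pose tl (z : 5.-tuple R) : 4.-tuple R := [tuple tnth z (lift ord0 i) | i < 4].
have minv : measurable_fun setT inv.
  apply/measurable_fun_tnthP => i.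
  rewrite (_ : _ \o inv = fun y => nth 0 (rot_jet c (- s) (tnth y (inord 0))
    (tnth y (inord 1)) (tnth y (inord 2)) (tnth y (inord 3))) i); last first.
    by apply/funext => y /=; rewrite tnth_mktuple.
  have mt (j : 'I_4) : measurable_fun setT (fun y : 4.-tuple R => tnth y j).
    exact: measurable_tnth.
  have mk (a : R) (j : 'I_4) : measurable_fun setT (fun y : 4.-tuple R => a * tnth y j).
    by apply: measurable_funM => //; exact: measurable_cst.
  case: i => [[|[|[|[|i]]]] i4] //=.
  - by apply: measurable_funD => //; exact: measurable_funD.
  - by apply: measurable_funD => //; exact: measurable_funB.
  - by apply: measurable_funD => //; exact: measurable_funD.
have mtl : measurable_fun setT tl.
  apply/measurable_fun_tnthP => i.
  rewrite (_ : _ \o tl = fun z => tnth z (lift ord0 i)); first exact: measurable_tnth.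
  by apply/funext => y /=; rewrite tnth_mktuple.
(* The event A, on which the jet lies in B, is also the event that the rotated
   jet lies in B'. By isotropy it can be traded for the event A' that the jet
   itself lies in B', where the regression of f t is known. *)
pose B' := inv @^-1` B.
have mB' : measurable B' by rewrite -[X in measurable X]setTI; exact: minv.
pose C := tl @^-1` B'.
have mC : measurable C by rewrite -[X in measurable X]setTI; exact: mtl.
pose psi1 (z : 5.-tuple R) := (tnth z ord0)%:E.
pose psi2 (z : 5.-tuple R) :=
  (dotv (vec 4 [:: alpha t; b11 t; b22 t; b12 t]) (\row_i tnth (tl z) i))%:E.
have mpsi1 : measurable_fun setT psi1 by apply/measurable_EFinP; exact: measurable_tnth.
have mpsi2 : measurable_fun setT psi2.
  apply/measurable_EFinP; apply: measurable_sum => i.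
  apply: measurable_funM; first exact: measurable_cst.
  under eq_fun do rewrite mxE.
  apply: (@measurableT_comp _ _ _ _ _ _ (fun z : 4.-tuple R => tnth z i)) => //.
  exact: measurable_tnth.
have [N [mN N0 mJ mJR law]] := jets_eq_law hf iso phi t.
pose J w : 5.-tuple R :=
  [tuple ((fun w => nth 0 (f t w :: jet f w) i) \_ (~` N)) w | i < 5].
pose JR w : 5.-tuple R :=
  [tuple ((fun w => nth 0 (f (Defs.rot phi t) w :: jetR f phi w) i) \_ (~` N)) w | i < 5].
have mtup (Z : 'I_5 -> Omega -> R) : (forall i, measurable_fun setT (Z i)) ->
    measurable_fun setT (fun w => [tuple Z i w | i < 5]).
  move=> mZ; apply/measurable_fun_tnthP => i.
  by rewrite (_ : _ \o _ = Z i)//; apply/funext => w /=; rewrite tnth_mktuple.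
have JE w : ~ N w -> J w = [tuple nth 0 (f t w :: jet f w) i | i < 5].
  move=> Nw; apply: eq_from_tnth => i; rewrite !tnth_mktuple patchE.
  by rewrite mem_set.
have JRE w : ~ N w ->
    JR w = [tuple nth 0 (f (Defs.rot phi t) w :: jetR f phi w) i | i < 5].
  move=> Nw; apply: eq_from_tnth => i; rewrite !tnth_mktuple patchE.
  by rewrite mem_set.
have tlE a (l : seq R) : tl [tuple nth 0 (a :: l) i | i < 5] = [tuple nth 0 l i | i < 4].
  by apply: eq_from_tnth => i; rewrite !tnth_mktuple.
have invE w : inv [tuple nth 0 (jetR f phi w) i | i < 4] =
    [tuple nth 0 (jet f w) i | i < 4].
  apply: eq_from_tnth => i; rewrite !tnth_mktuple !inordK//.
  by rewrite rot_jetK.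
have E1 : (\int[P]_(w in A) (f (Defs.rot phi t) w)%:E =
    \int[P]_(w in JR @^-1` C) psi1 (JR w))%E.
  apply: (eq_integral_null mN N0) => w Nw.
    by rewrite /preimage /C /B' /= JRE// tlE invE AE /= YE.
  by move=> _; rewrite JRE// /psi1 tnth_mktuple.
have E4 : (\int[P]_(w in JR @^-1` C) psi2 (JR w) =
   \int[P]_(w in A) (dotv (vec 4 [:: alpha t;
       c ^+ 2 * b11 t + s ^+ 2 * b22 t - c * s * b12 t;
       s ^+ 2 * b11 t + c ^+ 2 * b22 t + c * s * b12 t;
       2 * (c * s) * b11 t - 2 * (c * s) * b22 t
         + (c ^+ 2 - s ^+ 2) * b12 t]) (level_hess0 f w))%:E)%E.
  apply: (eq_integral_null mN N0) => w Nw.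
    by rewrite /preimage /C /B' /= JRE// tlE invE AE /= YE.
  move=> _; rewrite JRE// /psi2 tlE.
  rewrite (_ : (\row_i _) = vec 4 (jetR f phi w)); last first.
    by apply/rowP => i; rewrite !mxE tnth_mktuple.
  rewrite !dotv4 /jetR /rot_jet /= -/c -/s; congr EFin; ring.
pose A' := [set w | B' [tuple level_hess0 f w 0 i | i < 4]].
have sA' : sigma_of (fun i w => level_hess0 f w 0 i) A'.
  by apply/sigma_of_tuple; exists B'.
have E2 : (\int[P]_(w in J @^-1` C) psi1 (J w) = \int[P]_(w in A') (f t w)%:E)%E.
  apply: (eq_integral_null mN N0) => w Nw.
    by rewrite /preimage /C /A' /= JE// tlE YE.
  by move=> _; rewrite JE// /psi1 tnth_mktuple.
have E3 : (\int[P]_(w in J @^-1` C) psi2 (J w) = \int[P]_(w in A')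
     (dotv (vec 4 [:: alpha t; b11 t; b22 t; b12 t]) (level_hess0 f w))%:E)%E.
  apply: (eq_integral_null mN N0) => w Nw.
    by rewrite /preimage /C /A' /= JE// tlE YE.
  move=> _; rewrite JE// /psi2 tlE; congr (dotv _ _)%:E.
  by apply/rowP => i; rewrite !mxE tnth_mktuple.
rewrite E1 -E4.
rewrite (eq_law_integral (mtup _ mJR) (mtup _ mJ) law mpsi1 mC).
rewrite (eq_law_integral (mtup _ mJR) (mtup _ mJ) law mpsi2 mC).
by rewrite E2 E3; exact: (hab t).2.
Qed.

(** Turning the first axis to the direction [theta] reduces to the positivity for
    the Hessian matrix with the single nonzero entry 1. *)
Lemma b1_ge0 (k alpha b11 b22 b12 : _) (t : R * R) (theta : R) :
  monotonicity f k -> cond_mean_coefs f alpha b11 b22 b12 ->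
  0 <= b1 b11 b22 b12 t theta.
Proof.
move=> hmono hab.
have := mono_hess hmono (rotated_cond_mean (- theta) t hab).
by rewrite dotv4 cosN sinN /= /b1; congr (_ <= _); ring.
Qed.

Lemma b2_ge0 (k alpha b11 b22 b12 : _) (t : R * R) (theta : R) :
  monotonicity f k -> cond_mean_coefs f alpha b11 b22 b12 ->
  0 <= b2 b11 b22 b12 t theta.
Proof.
move=> hmono hab.
have := b1_ge0 t (theta + pi / 2) hmono hab.
by rewrite /b1 /b2 cosDpihalf sinDpihalf; congr (_ <= _); ring.
Qed.

Lemma alpha_le1 (k alpha b11 b22 b12 : _) (t : R * R) :
  monotonicity f k -> cond_mean_coefs f alpha b11 b22 b12 -> alpha t <= 1.
Proof.
move=> hmono hab; have := mono_level hmono (hab t).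
by rewrite dotv4 /= mulr1 !mulr0 !addr0.
Qed.

End rotated_regression.

(** * Taylor expansion of the radial covariance at the origin *)

Section even_taylor.
Context {R : realType}.
Implicit Types (G : R -> R).

Lemma is_derive_cvg_right G (dG x : R) : is_derive x 1 G dG ->
  (fun s => (G (x + s) - G x) / s) @ 0^'+ --> dG.
Proof.
move=> [dv <-]; move/cvg_ex: dv => [l Hl].
rewrite /derive (cvg_lim _ Hl)//.
apply: cvg_trans (cvg_dnbhs_at_right Hl).
apply: near_eq_cvg; near=> s => /=.
by rewrite /GRing.scale /= mulr1 mulrC (addrC s).
Unshelve. all: by end_near. Qed.

Lemma is_derive_continuous G (dG x : R) : is_derive x 1 G dG -> G @ x --> G x.
Proof. by move=> GdG; apply: differentiable_continuous; exact/derivable1_diffP. Qed.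

(** L'Hopital's rule against a power. *)
Lemma lhopital_pow G (dG : R -> R) n (L : R) :
  (forall x : R, is_derive x 1 G (dG x)) -> G 0 = 0 ->
  (fun s => dG s / s ^+ n) @ 0^'+ --> L ->
  (fun s => G s / s ^+ n.+1) @ 0^'+ --> L / n.+1%:R.
Proof.
move=> GdG G0 H.
pose dg (s : R) : R := n.+1%:R * s ^+ n.
(* Only the behaviour near 0 matters; 1 is an arbitrary right end. *)
apply: (@lhopital_at_right R G dG (fun s => s ^+ n.+1) dg 0 1) => //.
- move=> x _; split; first exact: exprn_derivable.
  by rewrite exp_derive /dg /GRing.scale /= mulr1 mulr_natl.
- rewrite -[X in _ --> X]G0; apply: cvg_at_right_filter.
  exact: (is_derive_continuous (GdG 0)).
- rewrite -[X in _ --> X](expr0n R n.+1); apply: cvg_at_right_filter.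
  exact: exprn_continuous.
- move=> x; rewrite in_itv /= => /andP[x0 _].
  by rewrite /dg mulf_neq0 ?pnatr_eq0// expf_neq0// gt_eqF.
- rewrite /dg; under eq_fun do rewrite invfM mulrCA mulrC.
  by apply: cvgM => //; exact: cvg_cst.
Qed.

Lemma cvg_right_comp (F u : R -> R) (l : R) :
  u @ 0 --> (0 : R) -> (forall r, 0 < r -> 0 < u r) ->
  F @ 0^'+ --> l -> (fun r => F (u r)) @ 0^'+ --> l.
Proof.
move=> u0 upos /cvg_at_rightP Fl; apply/cvg_at_rightP => v [v0 vl].
apply: (Fl (u \o v)); split => [n|]; first exact/upos/v0.
by apply: cvg_comp u0.
Qed.

Lemma cvg_right_sqrt (F : R -> R) (l : R) :
  F @ 0^'+ --> l -> (fun r => F (Num.sqrt r)) @ 0^'+ --> l.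
Proof.
apply: cvg_right_comp => [|r r0]; last by rewrite sqrtr_gt0.
by have := @sqrt_continuous R 0; rewrite /continuous_at sqrtr0.
Qed.

Lemma cvg_right_scale (F : R -> R) (a l : R) : 0 < a ->
  F @ 0^'+ --> l -> (fun r => F (a * r)) @ 0^'+ --> l.
Proof.
move=> a0; apply: cvg_right_comp => [|r r0]; last exact: mulr_gt0.
by rewrite -[X in _ --> X](mulr0 a); exact: mulrl_continuous.
Qed.

(** In the rest of the section [p1], ..., [p4] are the successive derivatives of
    an even function [p0], the last one is right-continuous at 0, and
    [p0 s = k (s ^+ 2)]. *)
Variables p0 p1 p2 p3 p4 : R -> R.
Hypothesis dp0 : forall x : R, is_derive x 1 p0 (p1 x).
Hypothesis dp1 : forall x : R, is_derive x 1 p1 (p2 x).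
Hypothesis dp2 : forall x : R, is_derive x 1 p2 (p3 x).
Hypothesis dp3 : forall x : R, is_derive x 1 p3 (p4 x).
Hypothesis cp4 : p4 @ 0^'+ --> p4 0.

(** Differentiation exchanges even functions ([e = 1]) and odd ones ([e = -1]). *)
Lemma derive_parity (G dG : R -> R) (e : R) :
  (forall x : R, is_derive x 1 G (dG x)) ->
  (forall x, G (- x) = e * G x) -> forall x, dG (- x) = - e * dG x.
Proof.
move=> GdG Ge x.
have D1 := @is_derive1_comp R G -%R x (dG (- x)) (-1) (GdG (- x)) (is_deriveNid x 1).
have D2 := is_deriveZ e (GdG x).
have E : G \o -%R = e *: G by apply/funext => y /=; rewrite Ge.
rewrite E in D1.
have := @derive_val _ _ _ _ _ _ _ D1; rewrite (@derive_val _ _ _ _ _ _ _ D2).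
by rewrite /GRing.scale /=; lra.
Qed.

Hypothesis even0 : forall x, p0 (- x) = p0 x.

Lemma odd_derivatives0 : p1 0 = 0 /\ p3 0 = 0.
Proof.
have e0 x : p0 (- x) = 1 * p0 x by rewrite mul1r.
have e1 := derive_parity dp0 e0.
have e2 := derive_parity dp1 e1.
have e3 := derive_parity dp2 e2.
by have := e1 0; have := e3 0; rewrite oppr0 !opprK; lra.
Qed.

Lemma taylor1 : (fun s => (p1 s - p2 0 * s) / s ^+ 3) @ 0^'+ --> p4 0 / 6.
Proof.
have [p10 p30] := odd_derivatives0.
have H3 : (fun s => p3 s / s ^+ 1) @ 0^'+ --> p4 0 / 1.
  apply: (lhopital_pow dp3 p30); under eq_fun do rewrite expr0 divr1.
  exact: cp4.
have H2 : (fun s => (p2 s - p2 0) / s ^+ 2) @ 0^'+ --> p4 0 / 1 / 2.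
  apply: (@lhopital_pow (fun s => p2 s - p2 0) p3 1) => //; last by rewrite subrr.
  move=> x; rewrite -[p3 x]subr0; apply: is_deriveB.
have -> : p4 0 / 6 = p4 0 / 1 / 2 / 3 by field.
apply: (@lhopital_pow (fun s => p1 s - p2 0 * s) (fun s => p2 s - p2 0) 2) => //.
  move=> x; apply: is_deriveB.
  rewrite -[X in is_derive _ _ _ X](mulr1 (p2 0)).
  exact: (is_deriveZ (p2 0) (is_derive_id x 1)).
by rewrite p10 mulr0 subrr.
Qed.

Lemma taylor0 :
  (fun s => (p0 s - p0 0 - p2 0 / 2 * s ^+ 2) / s ^+ 4) @ 0^'+ --> p4 0 / 24.
Proof.
have -> : p4 0 / 24 = p4 0 / 6 / 4 by field.
apply: (lhopital_pow _ _ taylor1).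
  move=> x; rewrite -[p1 x]subr0; apply: is_deriveB.
  have : is_derive x 1 ((p2 0 / 2) *: (fun s : R => s ^+ 2)) ((p2 0 / 2) *: (2 * x)).
    apply: is_deriveZ; split; first exact: exprn_derivable.
    by rewrite exp_derive /GRing.scale /= mulr1 mulr_natl.
  by congr is_derive; rewrite /GRing.scale /=; field.
by rewrite expr0n mulr0 !subrr.
Qed.

Variable k : R -> R.
Hypothesis p0k : forall s, p0 s = k (s ^+ 2).

Lemma k_sqrt r : 0 <= r -> k r = p0 (Num.sqrt r).
Proof. by move=> r0; rewrite p0k sqr_sqrtr. Qed.

Lemma k1E : k1 k = p2 0 / 2.
Proof.
rewrite /k1 /rderiv; apply: cvg_lim => //.
have T : (fun s : R => p2 0 / 2 + s ^+ 2 * ((p0 s - p0 0 - p2 0 / 2 * s ^+ 2) / s ^+ 4))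
     @ 0^'+ --> p2 0 / 2 + 0 ^+ 2 * (p4 0 / 24).
  apply: cvgD; first exact: cvg_cst.
  apply: cvgM; last exact: taylor0.
  by apply: cvg_at_right_filter; exact: exprn_continuous.
rewrite expr0n mul0r addr0 in T.
apply: cvg_trans (cvg_right_sqrt T); apply: near_eq_cvg; near=> r.
have r0 : 0 < r by [].
have sr0 : Num.sqrt r != 0 by rewrite gt_eqF// sqrtr_gt0.
rewrite add0r (k_sqrt (ltW r0)) -[X in k X](expr0n R 2) -p0k.
rewrite -[X in _ = _ / X](sqr_sqrtr (ltW r0)).
by field.
Unshelve. all: by end_near. Qed.

Lemma rderivE r : 0 < r -> rderiv k r = p1 (Num.sqrt r) / (2 * Num.sqrt r).
Proof.
move=> r0; rewrite /rderiv; apply: cvg_lim => //.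
have := is_derive_cvg_right
  (@is_derive1_comp R p0 Num.sqrt r _ _ (dp0 _) (is_derive1_sqrt r0)).
apply: cvg_trans; apply: near_eq_cvg; near=> s => /=.
by rewrite (k_sqrt (ltW r0)) k_sqrt// addr_ge0// ltW.
Unshelve. all: by end_near. Qed.

Lemma k2E : k2 k = p4 0 / 12.
Proof.
rewrite /k2 {1}/rderiv; apply: cvg_lim => //.
have T : (fun s : R => 2^-1 * ((p1 s - p2 0 * s) / s ^+ 3)) @ 0^'+ --> 2^-1 * (p4 0 / 6).
  by apply: cvgM taylor1; exact: cvg_cst.
have -> : p4 0 / 12 = 2^-1 * (p4 0 / 6) by field.
apply: cvg_trans (cvg_right_sqrt T); apply: near_eq_cvg; near=> r.
have r0 : 0 < r by [].
have sr0 : Num.sqrt r != 0 by rewrite gt_eqF// sqrtr_gt0.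
rewrite add0r rderivE// -/(k1 k) k1E.
rewrite -[X in _ = _ / X](sqr_sqrtr (ltW r0)).
by field.
Unshelve. all: by end_near. Qed.

Lemma taylor_k :
  (fun r => (k r - k 0 - k1 k * r) / r ^+ 2) @ 0^'+ --> k2 k / 2.
Proof.
have -> : k2 k / 2 = p4 0 / 24 by rewrite k2E; field.
apply: cvg_trans (cvg_right_sqrt taylor0); apply: near_eq_cvg; near=> r.
have r0 : 0 < r by [].
rewrite k1E (k_sqrt (ltW r0)) -[X in k X](expr0n R 2) -p0k sqr_sqrtr ?ltW//.
by rewrite -[4%N]/(2 * 2)%N exprM sqr_sqrtr ?ltW.
Unshelve. all: by end_near. Qed.

End even_taylor.

Section covariance_taylor.
Context {R : realType}.
Variables (K : R * R -> R) (k : R -> R) (eta : R).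
Hypothesis eta0 : 0 < eta.
Hypothesis K4 : C4holder eta K.
Hypothesis Kk : forall x, K x = k (normsq x).

(** A radial function of class C^(4 + eta) has a second-order expansion in the
    squared radius, with coefficients the one-sided derivatives of its profile. *)
Lemma radial_taylor :
  (fun r => (k r - k 0 - k1 k * r) / r ^+ 2) @ 0^'+ --> k2 k / 2.
Proof.
have [/= dK _ [dK1 _ [dK2 _ [dK3 _ hK4 _] _] _] _] := K4.
(* The restriction of h to the first axis. *)
pose sl (h : R * R -> R) s := h (0 + s, 0).
have dsl h : (forall y, derivable h y e1) ->
    forall s : R, is_derive s 1 (sl h) (sl (d1 h) s).
  by move=> dh s; exact: (is_derive_slice1 (0, 0) dh s).
have sK s : sl K s = k (s ^+ 2) by rewrite /sl Kk /normsq /= add0r expr0n addr0.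
apply: (taylor_k (dsl _ dK) (dsl _ dK1) (dsl _ dK2) (dsl _ dK3)) => //.
  have [C HC] := hK4 1.
  set h := d1 _ in HC *.
  apply/cvgrPdist_le => e e0; near=> s.
  have s0 : 0 < s by [].
  have s1 : s <= 1 by near: s; exact: nbhs_right_le.
  rewrite /sl addr0 add0r.
  have nrm (r : R) : `|((r, 0) : R * R)| = `|r|.
    by rewrite prod_normE /= normr0 max_l.
  apply: le_trans (HC (0, 0) (s, 0) _ _) _; rewrite ?nrm ?normr0 ?gtr0_norm//.
  rewrite [X in `|X|](_ : _ = (- s, 0)); last first.
    by congr pair => /=; rewrite ?subrr// sub0r.
  rewrite nrm normrN gtr0_norm//.
  have H1 : C * s `^ eta <= (`|C| + 1) * s `^ eta.
    by rewrite ler_wpM2r ?powR_ge0// (le_trans (ler_norm C))// lerDl.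
  apply: le_trans H1 _.
  rewrite -ler_pdivlMl ?ltr_wpDl//.
  near: s.
  have := powR_cvg0 eta0 => /cvgrPdist_le /(_ ((`|C| + 1)^-1 * e)).
  rewrite mulr_gt0 ?invr_gt0 ?ltr_wpDl// => /(_ isT).
  apply: filterS => s; rewrite sub0r normrN ger0_norm ?powR_ge0//.
by move=> s; rewrite !sK sqrrN.
Unshelve. all: by end_near. Qed.

End covariance_taylor.

(** * The covariance kernel as a positive semi-definite kernel *)

Section second_moments.
Context {R : realType} {d : measure_display} {Omega : measurableType d}.
Variable P : probability Omega R.
Variable f : R * R -> {RV P >-> R}.
Hypothesis hf : basic_assumption f.

Let mf x : measurable_fun setT (f x).
Proof. exact: measurable_funP. Qed.

Lemma measurable_pair_product : measurable_fun [set: 2.-tuple R]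
  (fun z => (tnth z ord0 * tnth z (lift ord0 ord0))%:E).
Proof.
apply/measurable_EFinP; apply: measurable_funM; exact: measurable_tnth.
Qed.

Lemma same_law_product (X Y : R * R -> {RV P >-> R}) x y : same_law X Y ->
  (\int[P]_w (X x w * X y w)%:E = \int[P]_w (Y x w * Y y w)%:E)%E.
Proof.
move=> XY.
pose p (i : 'I_2) : R * R := nth 0 [:: x; y] i.
have mtup (Z : R * R -> {RV P >-> R}) :
    measurable_fun setT (fun w => [tuple Z (p i) w | i < 2]).
  apply/measurable_fun_tnthP => i.
  rewrite (_ : _ \o _ = Z (p i)); first exact: measurable_funP.
  by apply/funext => w /=; rewrite tnth_mktuple.
have := eq_law_integral (mtup X) (mtup Y) (XY 2%N p) measurable_pair_product
  measurableT.
rewrite !preimage_setT.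
under eq_integral do rewrite !tnth_mktuple.
by under [in X in _ = X -> _]eq_integral do rewrite !tnth_mktuple.
Qed.

Lemma second_moment0 : (\int[P]_w (f 0%R w * f 0%R w)%:E = 1)%E.
Proof.
have := basic_var hf; rewrite /variance unlock (basic_centred hf 0) /=.
rewrite unlock => <-; apply: eq_integral => w _ /=.
by rewrite -[RHS]/(((f 0 w - 0) * (f 0 w - 0))%:E) subr0.
Qed.

Lemma second_moment x : (\int[P]_w (f x w * f x w)%:E = 1)%E.
Proof.
rewrite -second_moment0.
have := same_law_product 0 0 (basic_stationary hf x).
by rewrite add0r.
Qed.

Lemma integrable_product x y : P.-integrable setT (EFin \o (fun w => f x w * f y w)).
Proof.
have i2 z : P.-integrable setT (EFin \o (fun w => f z w * f z w)).
  apply/integrableP; split.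
    by apply/measurable_EFinP; exact: measurable_funM.
  under eq_integral do rewrite /= ger0_norm -?expr2 ?sqr_ge0//.
  by under eq_integral do rewrite expr2; rewrite second_moment ltry.
have mxy : measurable_fun setT (EFin \o (fun w => f x w * f y w)).
  by apply/measurable_EFinP; exact: measurable_funM.
apply: (le_integrable measurableT mxy _ (integrableD measurableT (i2 x) (i2 y))).
move=> w _ /=; rewrite lee_fin normrM.
have nE (a : R) : a * a = `|a| * `|a| by rewrite -normrM ger0_norm// -expr2 sqr_ge0.
rewrite (nE (f x w)) (nE (f y w)) [leRHS]ger0_norm ?addr_ge0 ?mulr_ge0//.
have := normr_ge0 (f x w); have := normr_ge0 (f y w).
move: (`|f x w|) (`|f y w|) => a b; nra.
Qed.

Lemma product_moment x y : (\int[P]_w (f x w * f y w)%:E = (K f (x - y))%:E)%E.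
Proof.
have := same_law_product (x - y) 0 (basic_stationary hf y).
rewrite subrK add0r => ->; rewrite /K unlock fineK//.
exact: (integrable_fin_num measurableT (integrable_product (x - y) 0)).
Qed.

Lemma covariance_psd m (a : 'I_m -> R) (p : 'I_m -> R * R) :
  0 <= \sum_i \sum_j a i * a j * K f (p i - p j).
Proof.
have E : (\int[P]_w ((\sum_i a i * f (p i) w) ^+ 2)%:E =
    (\sum_i \sum_j a i * a j * K f (p i - p j))%:E)%E.
  under eq_integral => w _.
    rewrite expr2 mulr_suml -sumEFin.
    under eq_bigr => i _.
      rewrite mulr_sumr -sumEFin.
      under eq_bigr => j _ do rewrite mulrACA EFinM.
      over.
    over.
  have ii i j : P.-integrable setT
      (fun w => (a i * a j)%:E * (f (p i) w * f (p j) w)%:E)%E.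
    by apply: integrableZl => //; exact: integrable_product.
  rewrite integral_sum//; last first.
    by move=> i; apply: integrable_sum => // j _; exact: ii.
  rewrite -sumEFin; apply: eq_bigr => i _.
  rewrite integral_sum// -sumEFin; apply: eq_bigr => j _.
  rewrite integralZl//; last exact: integrable_product.
  by rewrite product_moment EFinM.
rewrite -lee_fin -E; apply: integral_ge0 => w _.
by rewrite lee_fin sqr_ge0.
Qed.

End second_moments.

(** * The bound on chi *)

Section chi_bound.
Context {R : realType} {d : measure_display} {Omega : measurableType d}.
Variable P : probability Omega R.
Variable f : R * R -> {RV P >-> R}.
Variable k : R -> R.
Hypothesis hf : basic_assumption f.
Hypothesis hmono : monotonicity f k.

Lemma k_origin : k 0 = 1.
Proof.
have := mono_radial hmono 0; rewrite /normsq /= expr0n addr0 => <-.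
have := product_moment hf 0 0; rewrite subr0 second_moment0// => H.
by apply/eqP; rewrite -eqe -H.
Qed.

(** The Cauchy-Schwarz inequality between the value at the origin and the sum of
    the values at four points at distance [h] on the axes. *)
Lemma five_point_ineq (h : R) :
  16 * k (h ^+ 2) ^+ 2 <= 4 + 4 * k (4 * h ^+ 2) + 8 * k (2 * h ^+ 2).
Proof.
(* The weight at the origin minimises the quadratic form. *)
pose a (i : 'I_5) : R := nth 0 [:: - 4 * k (h ^+ 2); 1; 1; 1; 1] i.
pose p (i : 'I_5) : R * R := nth 0 [:: 0; (h, 0); (- h, 0); (0, h); (0, - h)] i.
have := covariance_psd hf a p.
rewrite !big_ord_recl !big_ord0 /a /p /= /bump /= !(mono_radial hmono) /normsq /=.
rewrite !(subr0, sub0r, subrr, opprK, expr0n, addr0, add0r, sqrrN) /=.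
have -> : (h + h) ^+ 2 = 4 * h ^+ 2 by ring.
have -> : (- h + h) ^+ 2 = 0 by ring.
rewrite k_origin.
have -> : (- h - h) ^+ 2 = 4 * h ^+ 2 by ring.
have -> : h ^+ 2 + h ^+ 2 = 2 * h ^+ 2 by ring.
by move=> H; rewrite -subr_ge0; move: H; congr (_ <= _); ring.
Qed.

(** The limit of [five_point_ineq] as the distance tends to 0. *)
Lemma k1_sqr_le : k1 k ^+ 2 <= 2 * k2 k.
Proof.
have [eta [/andP[eta0 _] K4]] := basic_K hf.
have T := radial_taylor eta0 K4 (mono_radial hmono).
(* The remainder of the first-order expansion of k, relative to r ^+ 2; the
   terms of order 0 and 1 in r cancel in five_point_ineq. *)
pose F r := (k r - k 0 - k1 k * r) / r ^+ 2.
have kF r : r != 0 -> k r = 1 + k1 k * r + F r * r ^+ 2.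
  by move=> r0; rewrite /F k_origin; field.
have L1 : (fun r => 16 * (k1 k + r * F r) ^+ 2) @ 0^'+ -->
    16 * (k1 k + 0 * (k2 k / 2)) ^+ 2.
  apply: cvgM; first exact: cvg_cst.
  have C : (fun r => k1 k + r * F r) @ 0^'+ --> k1 k + 0 * (k2 k / 2).
    apply: cvgD; first exact: cvg_cst.
    apply: cvgM => //; apply: cvg_at_right_filter; exact: cvg_id.
  exact: (cvgM C C).
have L2 : (fun r => 64 * F (4 * r) + 32 * F (2 * r) - 32 * F r) @ 0^'+ -->
    64 * (k2 k / 2) + 32 * (k2 k / 2) - 32 * (k2 k / 2).
  apply: cvgB.
    apply: cvgD; (apply: cvgM; first exact: cvg_cst).
      exact: (@cvg_right_scale _ F).
    exact: (@cvg_right_scale _ F).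
  by apply: cvgM; first exact: cvg_cst.
suff : 16 * (k1 k + 0 * (k2 k / 2)) ^+ 2 <=
    64 * (k2 k / 2) + 32 * (k2 k / 2) - 32 * (k2 k / 2).
  by rewrite mul0r addr0; lra.
apply: (ler_cvg_to L1 L2); near=> r.
have r0 : 0 < r by [].
have := five_point_ineq (Num.sqrt r); rewrite (sqr_sqrtr (ltW r0)).
rewrite !kF ?mulf_neq0 ?gt_eqF// => H.
have r2 : 0 < r ^+ 2 by rewrite exprn_gt0.
rewrite -(ler_pM2l r2) -subr_ge0; move: H; rewrite -subr_ge0.
by congr (_ <= _); ring.
Unshelve. all: by end_near. Qed.

Lemma chi_bounds : k1 k < 0 /\ chi k ^+ 2 <= 2.
Proof.
have := mono_chi hmono; rewrite /chi => chi1.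
have k2_gt0 : 0 < k2 k.
  rewrite ltNge; apply/negP => k20.
  by move: chi1; rewrite ler0_sqrtr// invr0 mulr0; lra.
have s0 : 0 < Num.sqrt (k2 k) by rewrite sqrtr_gt0.
split.
  move: chi1; rewrite ler_pdivlMr// mul1r; lra.
rewrite exprMn sqrrN exprVn (sqr_sqrtr (ltW k2_gt0)) ler_pdivrMr//.
exact: k1_sqr_le.
Qed.

Lemma drift_le0 : mu k * (1 + tau k) <= 0.
Proof.
have [k1_lt0 chi2] := chi_bounds.
rewrite mulr_le0_ge0//; first by rewrite /mu; lra.
rewrite /tau.
have -> : 1 + (chi k ^+ 2 - 1) / (3 - chi k ^+ 2) = 2 / (3 - chi k ^+ 2).
  by field; rewrite gt_eqF// subr_gt0 (le_lt_trans chi2)// ltr_nat.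
by rewrite divr_ge0// subr_ge0 (le_trans chi2)// ler_nat.
Qed.

End chi_bound.

(** * Change of variables in the density of the eigenvalues *)

Section density_change.
Local Open Scope ereal_scope.
Context {d d' : measure_display} {X : measurableType d} {Y : measurableType d'}.
Context {R : realType}.
Variables (mu : {measure set X -> \bar R}) (m : {measure set Y -> \bar R}).
Variables (u : X -> Y) (g : X -> R).
Hypothesis mu_u : measurable_fun setT u.
Hypothesis mg : measurable_fun setT g.
Hypothesis g0 : forall x, (0 <= g x)%R.
Hypothesis mE : forall A, measurable A -> m A = \int[mu]_(x in u @^-1` A) (g x)%:E.

Import HBNNSimple.

(** If [m] is the image under [u] of the measure with density [g], then
    integrals against [m] are weighted integrals. *)
Lemma integral_density_image (h : Y -> \bar R) : measurable_fun setT h ->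
  (forall y, 0 <= h y) -> \int[m]_y h y = \int[mu]_x ((g x)%:E * h (u x)).
Proof.
move=> mh h0; pose h_ := nnsfun_approx measurableT mh.
have mpre A : measurable A -> measurable (u @^-1` A).
  by move=> mA; rewrite -[X in measurable X]setTI; exact: mu_u.
have hE y : h y = limn (fun n => (h_ n y)%:E).
  by apply/esym/cvg_lim => //; exact: cvg_nnsfun_approx.
have step n : \int[m]_y (h_ n y)%:E = \int[mu]_x ((g x)%:E * (h_ n (u x))%:E).
  transitivity (\sum_(r \in range (h_ n)) \int[m]_y (r * \1_(h_ n @^-1` [set r]) y)%:E).
    under eq_integral do rewrite fimfunE -fsumEFin//.
    rewrite ge0_integral_fsum//.
    - by move=> r; apply/measurable_EFinP/measurable_funM => //; exact: measurable_indic.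
    - by move=> r y _; rewrite nnfun_muleindic_ge0.
  transitivity (\sum_(r \in range (h_ n))
      \int[mu]_x ((g x)%:E * (r * \1_(h_ n @^-1` [set r]) (u x))%:E)); last first.
    rewrite -ge0_integral_fsum//.
    - apply: eq_integral => x _; rewrite fimfunE -fsumEFin// ge0_mule_fsumr//.
      by move=> r; rewrite nnfun_muleindic_ge0.
    - move=> r; apply: emeasurable_funM; first exact/measurable_EFinP.
    apply/measurable_EFinP.
      apply: measurable_funM => //; apply: measurableT_comp => //;
      exact: measurable_indic.
    - by move=> r x _; apply: mule_ge0; [rewrite lee_fin|exact: nnfun_muleindic_ge0].
  apply: eq_fsbigr => r /[!inE] -[y _ hr].
  have r0 : (0 <= r)%R by rewrite -hr.
  rewrite integralZl_indic_nnsfun// integral_indic// setIT mE//.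
  rewrite -ge0_integralZl//.
  - rewrite [LHS]integral_mkcond; apply: eq_integral => x _.
    rewrite patchE indicE [x \in _](_ : _ = (u x \in h_ n @^-1` [set r]))//.
    by case: ifP => _; rewrite ?mulr1 ?mulr0 ?mule0// muleC.
  - exact: mpre.
  - by apply: measurable_funTS; exact/measurable_EFinP.
  - by move=> x _; rewrite lee_fin.
have nd y a b : (a <= b)%N -> (h_ a y)%:E <= (h_ b y)%:E.
  by move=> ab; rewrite lee_fin; exact/lefP/nd_nnsfun_approx.
transitivity (limn (fun n => \int[m]_y (h_ n y)%:E)).
  rewrite -monotone_convergence//.
  - by apply: eq_integral => y _; exact: hE.
  - by move=> n; exact/measurable_EFinP.
  - by move=> n y _; rewrite lee_fin.
  - by move=> y _ a b ab; exact: nd.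
under eq_fun do rewrite step.
rewrite -monotone_convergence//.
- apply: eq_integral => x _; rewrite hE; rewrite limeMl//.
  by apply/cvg_ex; exists (h (u x)); exact: cvg_nnsfun_approx.
- move=> n; apply: emeasurable_funM; apply/measurable_EFinP => //.
  exact: measurableT_comp.
- by move=> n x _; rewrite mule_ge0// lee_fin.
- by move=> x _ a b ab; apply: lee_wpmul2l; [rewrite lee_fin|exact: nd].
Qed.

End density_change.

Section lebesgue_images.
Context {R : realType}.
Local Notation leb := (@lebesgue_measure R).

Lemma lebesgue_ocitv (a b : R) : leb `]a, b] = (Num.max 0 (b - a))%:E.
Proof.
rewrite lebesgue_measure_itv /= lte_fin; case: ltP => ab.
  by rewrite max_r ?subr_ge0 1?ltW.
by rewrite max_l// subr_le0.
Qed.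

(** Translation invariance of the Lebesgue integral. *)
Lemma lebesgue_translation (a : R) (F : R -> \bar R) :
  measurable_fun setT F -> (forall x, 0 <= F x)%E ->
  (\int[leb]_x F (x + a)%R = \int[leb]_x F x)%E.
Proof.
move=> mF F0.
have mt : measurable_fun [set: R] (fun x : R => x + a).
  by apply: measurable_funD => //; exact: measurable_cst.
have := @ge0_integral_pushforward _ _ (measurableTypeR R) (measurableTypeR R) R
  (fun x => x + a) mt leb setT F measurableT mF (fun x _ => F0 x).
rewrite preimage_setT => <-.
apply/esym/eq_measure_integral => A mA _.
pose m : {measure set (measurableTypeR R) -> \bar R} :=
  
  @measure_function_pushforward__canonical__measure_function_Measure _ _
    (measurableTypeR R) (measurableTypeR R) R leb _ mt.
rewrite -[RHS]/(m A).
apply: (lebesgue_measure_unique (mu := m)) => // _ [[x y] _ <-] /=.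
rewrite /pushforward.
rewrite (_ : _ @^-1` _ = `]x - a, y - a]%classic).
  by rewrite !lebesgue_ocitv; congr (Num.max _ _)%:E; ring.
by apply/seteqP; split => z; rewrite /= !in_itv /= ltrBlDr lerBrDr.
Qed.

Variable s : R.

(** For fixed s, the map x |-> x ^+ 2 - s * x = - x (s - x) is decreasing from
    the numbers x below min 0 s onto ]0, +oo[, and [left_root] is its inverse. *)
Definition left_root (T : R) : R := (s - Num.sqrt (s ^+ 2 + 4 * T)) / 2.

Let u (x : R) : R := x ^+ 2 - s * x.
Let g (x : R) : R := if (x < 0) && (x < s) then s - 2 * x else 0.

Let g_ge0 x : 0 <= g x.
Proof. by rewrite /g; case: ifPn => // /andP[x0 xs]; lra. Qed.

Let mu_ : measurable_fun [set: R] u.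
Proof.
apply: continuous_measurable_fun => x; apply: cvgB; first exact: exprn_continuous.
exact: mulrl_continuous.
Qed.

Let mg : measurable_fun [set: R] g.
Proof.
apply: measurable_fun_ifT.
- apply: measurable_and; apply: measurable_fun_ltr => //; exact: measurable_cst.
- apply: measurable_funB; first exact: measurable_cst.
  by apply: measurable_funM => //; exact: measurable_cst.
- exact: measurable_cst.
Qed.

(** The image under [u] of the measure whose density [g] is minus the derivative
    of [u] below min 0 s, and 0 elsewhere; it is shown to be the Lebesgue measure
    of ]0, +oo[. *)
Let nu (A : set (measurableTypeR R)) : \bar R := (\int[leb]_(x in u @^-1` A) (g x)%:E)%E.

Let mpre (A : set (measurableTypeR R)) :
  measurable A -> measurable (u @^-1` A : set (measurableTypeR R)).
Proof. by move=> mA; rewrite -[X in measurable X]setTI; exact: mu_. Qed.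

Let nu0 : nu set0 = 0%E.
Proof. by rewrite /nu preimage_set0 integral_set0. Qed.

Let nu_ge0 A : (0 <= nu A)%E.
Proof. by apply: integral_ge0 => x _; rewrite lee_fin. Qed.

Let nu_sigma_additive : semi_sigma_additive nu.
Proof.
move=> /= A mA tA mUA; rewrite /nu preimage_bigcup ge0_integral_bigcup//=.
- apply: is_cvg_ereal_nneg_natsum_cond => n _ _; exact: nu_ge0.
- by move=> n; exact: (mpre (mA n)).
- by apply: measurable_funTS; apply/measurable_EFinP; exact: mg.
- by move=> x _; rewrite lee_fin.
- apply/trivIsetP => i j _ _ ij; rewrite -preimage_setI.
  by move/trivIsetP : tA => /(_ _ _ _ _ ij) ->//; rewrite preimage_set0.
Qed.

HB.instance Definition _ := isMeasure.Build _ _ _ nu nu0 nu_ge0 nu_sigma_additive.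

Lemma left_rootK T : 0 <= T -> u (left_root T) = T.
Proof.
move=> T0; rewrite /u /left_root.
have := @sqr_sqrtr _ (s ^+ 2 + 4 * T); rewrite addr_ge0 ?sqr_ge0 ?mulr_ge0// => /(_ isT).
by move: (Num.sqrt _) => r r2; lra.
Qed.

Lemma left_root_u x : x < 0 -> x < s -> left_root (u x) = x.
Proof.
move=> x0 xs; rewrite /left_root /u.
rewrite (_ : s ^+ 2 + _ = (s - 2 * x) ^+ 2); last by ring.
by rewrite sqrtr_sqr ger0_norm; lra.
Qed.

Lemma left_root_lt T T' : 0 <= T -> T < T' -> left_root T' < left_root T.
Proof.
move=> T0 TT'; rewrite /left_root ltr_pM2r ?invr_gt0// ltrD2l ltrN2 ltr_sqrt.
  by rewrite ltrD2l; lra.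
by rewrite ltr_wpDl ?sqr_ge0//; lra.
Qed.

Let u_gt0 x : x < 0 -> x < s -> 0 < u x.
Proof.
move=> x0 xs; rewrite /u (_ : _ - _ = - x * (s - x)); last by ring.
by rewrite mulr_gt0 ?oppr_gt0 ?subr_gt0.
Qed.

Let mem_arc (a b x : R) : 0 <= a -> a < b ->
  (x \in `[left_root b, left_root a[) =
  [&& x < 0, x < s & u x \in `]a, b]].
Proof.
move=> a0 ab; have b0 : 0 < b by exact: le_lt_trans ab.
have mono T T' : 0 <= T -> T <= T' -> left_root T' <= left_root T.
  move=> T0; rewrite le_eqVlt => /orP[/eqP->//|TT']; exact/ltW/left_root_lt.
apply/idP/idP.
  rewrite in_itv /= => /andP[bx xa].
  have [xneg xs] : x < 0 /\ x < s.
    have : left_root a <= left_root 0 by exact: mono.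
    rewrite [in X in _ <= X]/left_root mulr0 addr0 sqrtr_sqr => a0'.
    by have := ler_norm s; have := ler_norm (- s); rewrite normrN; lra.
  have u0 := u_gt0 xneg xs.
  rewrite xneg xs /= in_itv /=; apply/andP; split.
    rewrite ltNge; apply/negP => ua.
    by have := mono _ _ (ltW u0) ua; rewrite left_root_u//; lra.
  rewrite leNgt; apply/negP => bu.
  by have := left_root_lt (ltW b0) bu; rewrite left_root_u//; lra.
move=> /and3P[xneg xs]; rewrite !in_itv /= => /andP[au ub].
have u0 := u_gt0 xneg xs.
rewrite -(left_root_u xneg xs); apply/andP; split.
  by apply: mono => //; exact: ltW.
exact: left_root_lt.
Qed.

(** The mass that [nu] gives to ]a, b]. *)
Lemma integral_arc (a b : R) : 0 <= a -> a < b ->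
  (\int[leb]_(x in `[left_root b, left_root a[) (s - 2 * x)%:E = (b - a)%:E)%E.
Proof.
move=> a0 ab.
have cf : continuous (fun x : R => s - 2 * x).
  by move=> x; apply: cvgB; [exact: cvg_cst|exact: mulrl_continuous].
rewrite integral_itv_bndo_bndc; last first.
  by apply: measurable_funTS; apply/measurable_EFinP; exact: continuous_measurable_fun.
have dF (x : R) : is_derive x 1 (- u) (s - 2 * x).
  have D2 : is_derive x 1 (fun x : R => x ^+ 2) (2 * x).
    by split; [exact: exprn_derivable|rewrite exp_derive /GRing.scale /= mulr1 mulr_natl].
  have D1 := is_deriveZ s (is_derive_id x 1).
  have := is_deriveN (is_deriveB D2 D1).
  by congr is_derive; rewrite /GRing.scale /=; ring.
rewrite (@continuous_FTC2 _ _ (- u)).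
- rewrite -EFinB; congr EFin.
  rewrite -[LHS]/(- u (left_root a) - - u (left_root b)).
  by rewrite !left_rootK//; [ring|rewrite ltW// (le_lt_trans a0)].
- exact: left_root_lt.
- exact: continuous_subspaceT.
- split.
  + by move=> x _; exact: ex_derive.
  + by apply: cvg_at_right_filter; exact: (is_derive_continuous (dF _)).
  + by apply: cvg_at_left_filter; exact: (is_derive_continuous (dF _)).
- by move=> x _; rewrite derive1E; exact: derive_val.
Qed.

Let nu_ocitv (a b : R) : leb (`]a, b] `&` `]0, +oo[) = nu `]a, b].
Proof.
have -> : `]a, b] `&` `]0, +oo[ = `]Num.max 0 a, b]%classic :> set R.
  apply/seteqP; split => x; rewrite /= !in_itv /= andbT gt_max.
    by move=> [/andP[-> ->] ->].
  by move=> /andP[/andP[-> ->] ->].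
set a' := Num.max 0 a.
have a'0 : 0 <= a' by rewrite le_max lexx.
have nuE : nu `]a, b] = nu `]a', b].
  rewrite /nu [LHS]integral_mkcond [RHS]integral_mkcond; apply: eq_integral => x _.
  rewrite !patchE /g.
  have [/andP[x0 xs]|_] := boolP ((x < 0) && (x < s)); last by rewrite !if_same.
  have u0 := u_gt0 x0 xs.
  rewrite (_ : (x \in u @^-1` `]a', b]) = (x \in u @^-1` `]a, b]))//.
  by apply/idP/idP; rewrite !inE /= !in_itv /= gt_max u0.
rewrite nuE; have [a'b|ba'] := ltP a' b; last first.
  rewrite set_itv_ge ?bnd_simp -?leNgt// measure0 /nu.
  by rewrite preimage_set0 integral_set0.
rewrite lebesgue_ocitv max_r ?subr_ge0 ?(ltW a'b)//.
rewrite -integral_arc// /nu [LHS]integral_mkcond [RHS]integral_mkcond.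
apply: eq_integral => x _; rewrite !patchE /g.
rewrite (_ : (x \in `[left_root b, left_root a'[%classic) =
  [&& x < 0, x < s & u x \in `]a', b]]); last first.
  by rewrite mem_setE mem_arc.
rewrite (_ : (x \in u @^-1` `]a', b]) = (u x \in `]a', b])); last first.
  by apply/idP/idP => [|H]; rewrite inE ; [move=> H|]; exact: H.
by case: (x < 0); case: (x < s) => //=; rewrite ?if_same.
Qed.

Let nuE A : measurable A -> mrestr leb (measurable_itv `]0, +oo[) A = nu A.
Proof.
move=> mA.
pose m1 : {measure set (measurableTypeR R) -> \bar R} :=
  mrestr leb (measurable_itv `]0, +oo[).
pose m2 : {measure set (measurableTypeR R) -> \bar R} := nu.
have H := @measure_unique _ R (measurableTypeR R) (@ocitv R)
  (fun n => `]- n%:R, n%:R]%classic).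
apply: (H _ _ _ _ m1 m2 _ _ A mA) => //.
- exact: ocitvI.
- by move=> n; exact: is_ocitv.
- by rewrite bigcup_itvT.
- by move=> _ [[a b] _ <-]; exact: nu_ocitv.
- move=> n; apply: (@le_lt_trans _ _ (leb `]- n%:R, n%:R])).
    by apply: le_measure; rewrite ?inE//; exact: measurableI.
  by rewrite lebesgue_ocitv ltry.
Qed.

Let integral_halfline (h : R -> \bar R) : measurable_fun [set: measurableTypeR R] h ->
  (forall T, 0 <= h T)%E ->
  (\int[mrestr leb (measurable_itv `]0%R, +oo[)]_T h T =
   \int[leb]_(T in `]0%R, +oo[) h T)%E.
Proof.
move=> mh h0.
rewrite (@integral_density_image _ _ (measurableTypeR R) (measurableTypeR R) R
  leb (mrestr leb (measurable_itv `]0%R, +oo[)) id (\1_(`]0%R, +oo[%classic))) //.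
- rewrite [RHS]integral_mkcond; apply: eq_integral => x _.
  by rewrite patchE indicE; case: ifP => _; rewrite ?mul1e ?mul0e.
- by move=> A mA; rewrite integral_indic//= setIC.
Qed.

(** Substitution of T = x ^+ 2 - s * x, for measurable integrands. *)
Lemma integral_parabola (h : R -> \bar R) : measurable_fun setT h ->
  (forall T, 0 <= h T)%E ->
  (\int[leb]_(T in `]0%R, +oo[) h T =
   \int[leb]_x ((if (x < 0) && (x < s) then s - 2 * x else 0)%:E
                * h (x ^+ 2 - s * x)%R))%E.
Proof.
move=> mh h0.
rewrite -(integral_halfline mh h0).
exact: (@integral_density_image _ _ (measurableTypeR R) (measurableTypeR R) R
  leb (mrestr leb (measurable_itv `]0%R, +oo[)) u g mu_ mg g_ge0 nuE h mh h0).
Qed.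

End lebesgue_images.

(** * Stochastic monotonicity of the eigenvalues in the level *)

Section saddle_density.
Context {R : realType}.
Local Notation leb := (@lebesgue_measure R).
Variable k : R -> R.

(** At level [l] the law of x + y is the law at level 0 translated by
    [drift * l]. *)
Definition drift : R := mu k * (1 + tau k).

(** The densities, up to constants, of the sum x + y recentred by [drift * l] and
    of the product T = - x y, and the factor that depends on the level alone. *)
Definition sum_weight (s : R) : R := expR (- (2 * sigma2 k)^-1 * s ^+ 2).
Definition product_weight (T : R) : R :=
  if 0 < T then T * expR (- (2 * sigma2 k)^-1 * (2 * (1 - tau k) * T)) else 0.
Definition level_weight (l : R) : R :=
  expR (- (2 * sigma2 k)^-1 * (2 * (1 + tau k) * (mu k * l) ^+ 2 - (drift * l) ^+ 2)).

(** [left_root s T] and [right_root s T] are the two numbers with sum [s] and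
    product [- T]. *)
Definition right_root (s T : R) : R := s - left_root s T.

(** At a fixed product both roots increase with their sum. *)
Lemma left_root_le (s s' T : R) : 0 <= T -> s <= s' -> left_root s T <= left_root s' T.
Proof.
move=> T0 ss'; rewrite /left_root ler_pM2r ?invr_gt0//.
have r0 (a : R) : 0 <= a ^+ 2 + 4 * T by rewrite addr_ge0 ?sqr_ge0 ?mulr_ge0.
have := sqr_sqrtr (r0 s); have := sqr_sqrtr (r0 s').
have ha (a : R) : `|a| <= Num.sqrt (a ^+ 2 + 4 * T).
  by rewrite -sqrtr_sqr ler_wsqrtr// lerDl mulr_ge0.
move: (ha s) (ha s'); move: (Num.sqrt _) (Num.sqrt _) => r r' hr hr' E' E.
have := ler_norm s'; have := ler_norm (- s); have := ler_norm s.
have := ler_norm (- s'); rewrite !normrN => h1 h2 h3 h4.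
rewrite leNgt; apply/negP => H.
have p1 : 0 <= (s' - s) * (r + r' - s - s') by rewrite mulr_ge0; lra.
have p2 : 0 < (r - r' - (s' - s)) * (r + r') by rewrite mulr_gt0; lra.
by lra.
Qed.

Lemma right_root_le (s s' T : R) : 0 <= T -> s <= s' -> right_root s T <= right_root s' T.
Proof.
move=> T0 ss'.
have E (a : R) : right_root a T = - left_root (- a) T.
  by rewrite /right_root /left_root sqrrN; field.
by rewrite !E lerN2 left_root_le// lerN2.
Qed.

(** The density in the coordinates x + y and - x y; the factor y - x is the
    Jacobian determinant. *)
Lemma q_roots l x y : 0 < y -> x < 0 ->
  q k l x y = (y - x) *
    (level_weight l * sum_weight ((x + y) - drift * l) * product_weight (- x * y)).
Proof.
move=> y0 x0; rewrite /q y0 x0 /= ltr0_norm// /product_weight mulr_gt0 ?oppr_gt0//.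
set e := expR _.
suff -> : e = level_weight l * sum_weight ((x + y) - drift * l) *
    expR (- (2 * sigma2 k)^-1 * (2 * (1 - tau k) * (- x * y))).
  by ring.
by rewrite /e /level_weight /sum_weight -!expRD; congr expR; rewrite /drift; ring.
Qed.

Lemma sum_weight_ge0 s : 0 <= sum_weight s. Proof. exact: expR_ge0. Qed.
Lemma level_weight_gt0 l : 0 < level_weight l. Proof. exact: expR_gt0. Qed.
Lemma product_weight_ge0 T : 0 <= product_weight T.
Proof.
by rewrite /product_weight; case: ifPn => // T0; rewrite mulr_ge0 ?expR_ge0// ltW.
Qed.

#[local] Hint Resolve sum_weight_ge0 product_weight_ge0 level_weight_gt0 : core.

Lemma q_ge0 l x y : 0 <= q k l x y.
Proof.
rewrite /q; case: ifPn => // /andP[y0 x0].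
by rewrite !mulr_ge0 ?expR_ge0 ?(ltW y0)//; lra.
Qed.

Let mws : measurable_fun [set: R] sum_weight.
Proof.
apply: measurableT_comp => //; apply: measurable_funM; first exact: measurable_cst.
exact: exprn_measurable.
Qed.

Let mwT : measurable_fun [set: R] product_weight.
Proof.
apply: measurable_fun_ifT.
- by apply: measurable_fun_ltr => //; exact: measurable_cst.
- apply: measurable_funM => //; apply: measurableT_comp => //.
  apply: measurable_funM; first exact: measurable_cst.
  by apply: measurable_funM => //; exact: measurable_cst.
- exact: measurable_cst.
Qed.

Let mroot : measurable_fun [set: R * R] (fun z => left_root z.1 z.2).
Proof.
apply: measurable_funM; last exact: measurable_cst.
apply: measurable_funB => //.
apply: (@measurableT_comp _ _ _ _ _ _ (@Num.sqrt R)).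
  by apply: continuous_measurable_fun; exact: sqrt_continuous.
apply: measurable_funD.
  apply: (@measurableT_comp _ _ _ _ _ _ (fun x : R => x ^+ 2)).
    exact: exprn_measurable.
  exact: measurable_fst.
by apply: measurable_funM => //; exact: measurable_cst.
Qed.

Let mright : measurable_fun [set: R * R] (fun z => right_root z.1 z.2).
Proof. by apply: measurable_funB. Qed.

Let mq l : measurable_fun [set: R * R] (fun z => q k l z.1 z.2).
Proof.
apply: measurable_fun_ifT.
- by apply: measurable_and; apply: measurable_fun_ltr => //; exact: measurable_cst.
- apply: measurable_funM; last first.
    apply: measurableT_comp => //; apply: measurable_funM; first exact: measurable_cst.
    have ms (p : R * R -> R) : measurable_fun setT p ->
        measurable_fun setT (fun z => p z - mu k * l).
      by move=> mp; apply: measurable_funB => //; exact: measurable_cst.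
    have m1 := ms _ (@measurable_fst _ _ R R); have m2 := ms _ (@measurable_snd _ _ R R).
    apply: measurable_funD; last first.
      apply: measurable_funM => //; apply: measurable_funM => //;
      exact: measurable_cst.
    by apply: measurable_funD; apply: measurable_funM.
  apply: measurable_funM; last exact: measurable_funB.
  by apply: measurable_funM => //; exact: measurableT_comp.
- exact: measurable_cst.
Qed.

(** The integrand and the integral of [G] against the density, up to
    [level_weight], in the coordinates s = x + y - drift * l and T = - x y. *)
Definition split_integrand (l : R) (G : R * R -> R) (z : R * R) : R :=
  sum_weight z.1 * product_weight z.2 *
  G (left_root (z.1 + drift * l) z.2, right_root (z.1 + drift * l) z.2).

Definition split_integral (l : R) (G : R * R -> R) : \bar R :=
  (\int[leb]_s \int[leb]_T (split_integrand l G (s, T))%:E)%E.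

Variable G : R * R -> R.
Hypothesis mG : measurable_fun setT G.
Hypothesis G0 : forall z, 0 <= G z.

(** In the coordinates s = x + y and T = - x y the density splits. *)
Lemma integral_q_split l :
  (\int[leb \x leb]_z (q k l z.1 z.2 * G z)%:E =
   \int[leb]_s \int[leb]_T
     (level_weight l * sum_weight (s - drift * l) * product_weight T *
      G (left_root s T, right_root s T))%:E)%E.
Proof.
pose F (z : R * R) := (q k l z.1 z.2 * G z)%:E.
have mF : measurable_fun [set: R * R] F.
  by apply/measurable_EFinP; apply: measurable_funM.
have F0 z : (0 <= F z)%E by rewrite lee_fin mulr_ge0// q_ge0.
pose H (z : R * R) := F (z.1, z.2 - z.1).
have mH : measurable_fun [set: R * R] H.
  apply: (@measurableT_comp _ _ _ _ _ _ F) => //.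
  by apply: measurable_fun_pair => //; exact: measurable_funB.
have H0 z : (0 <= H z)%E by exact: F0.
(* Tonelli, then y = s - x for fixed x, then Tonelli again, then the parabola for
   fixed s. *)
rewrite (@fubini_tonelli1 _ _ (measurableTypeR R) (measurableTypeR R) R leb leb
  F mF F0) /fubini_F.
transitivity (\int[leb]_x \int[leb]_s H (x, s))%E.
  apply: eq_integral => x _.
  rewrite -(@lebesgue_translation _ (- x) (fun y => F (x, y)))//.
  exact: measurable_fun_pair2.
rewrite (@fubini_tonelli _ _ (measurableTypeR R) (measurableTypeR R) R leb leb
  H mH H0).
apply: eq_integral => s _.
pose h (T : R) := (level_weight l * sum_weight (s - drift * l) *
  product_weight T * G (left_root s T, right_root s T))%:E.
have mh : measurable_fun [set: R] h.
  apply/measurable_EFinP; apply: measurable_funM.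
    by apply: measurable_funM => //; exact: measurable_cst.
  apply: (@measurableT_comp _ _ _ _ _ _ G) => //.
  apply: measurable_fun_pair.
    exact: (measurable_fun_pair2 s mroot).
  exact: (measurable_fun_pair2 s mright).
have h0 T : (0 <= h T)%E by rewrite lee_fin !mulr_ge0// ltW.
transitivity (\int[leb]_(T in `]0%R, +oo[) h T)%E; last first.
  rewrite integral_mkcond; apply: eq_integral => T _.
  rewrite patchE mem_setE in_itv /= andbT.
  by case: ifPn => //; rewrite /h /product_weight => /negbTE ->; rewrite mulr0 mul0r.
rewrite (integral_parabola s mh h0); apply: eq_integral => x _.
rewrite /H /F /=; case: ifPn => [/andP[x0 xs]|nx]; last first.
  rewrite mul0e /q subr_gt0 andbC; move: nx.
  by case: (x < 0) => //=; case: (x < s) => //= _; rewrite mul0r.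
rewrite q_roots ?subr_gt0// /h -EFinM left_root_u// /right_root left_root_u//.
have -> : x + (s - x) = s by ring.
have -> : - x * (s - x) = x ^+ 2 - s * x by ring.
by congr EFin; ring.
Qed.

Lemma measurable_split_integrand l :
  measurable_fun [set: R * R] (fun z => (split_integrand l G z)%:E).
Proof.
apply/measurable_EFinP; apply: measurable_funM; last first.
  apply: (@measurableT_comp _ _ _ _ _ _ G) => //.
  have ms : measurable_fun [set: R * R] (fun z : R * R => (z.1 + drift * l, z.2)).
    by apply: measurable_fun_pair => //; apply: measurable_funD => //; exact: measurable_cst.
  apply: measurable_fun_pair.
    exact: (measurableT_comp mroot ms).
  exact: (measurableT_comp mright ms).
by apply: measurable_funM; exact: measurableT_comp.
Qed.

Lemma split_integrand_ge0 l z : 0 <= split_integrand l G z.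
Proof. by rewrite !mulr_ge0. Qed.

(** The sum is translated by [drift * l]; apart from a constant, the level then
    only enters through the argument of [G]. *)
Lemma integral_q_shift l :
  (\int[leb \x leb]_z (q k l z.1 z.2 * G z)%:E =
   (level_weight l)%:E * split_integral l G)%E.
Proof.
rewrite integral_q_split.
pose F (z : R * R) := (level_weight l * sum_weight (z.1 - drift * l) *
  product_weight z.2 * G (left_root z.1 z.2, right_root z.1 z.2))%:E.
have mF : measurable_fun [set: R * R] F.
  apply/measurable_EFinP; apply: measurable_funM; last first.
    by apply: (@measurableT_comp _ _ _ _ _ _ G) => //; exact: measurable_fun_pair.
  apply: measurable_funM; last exact: measurableT_comp.
  apply: measurable_funM; first exact: measurable_cst.
  apply: measurableT_comp => //; apply: measurable_funB => //; exact: measurable_cst.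
have F0 z : (0 <= F z)%E by rewrite lee_fin !mulr_ge0// ltW.
pose F' z := (split_integrand l G z)%:E.
have mF' := measurable_split_integrand l.
have F'0 z : (0 <= F' z)%E by rewrite lee_fin split_integrand_ge0.
rewrite -(@lebesgue_translation _ (drift * l)); last 2 first.
- exact: (@measurable_fun_fubini_tonelli_F _ _ (measurableTypeR R)
    (measurableTypeR R) R leb F mF F0).
- by move=> s; apply: integral_ge0 => T _; exact: (F0 (s, T)).
rewrite -ge0_integralZl//; last 3 first.
- exact: (@measurable_fun_fubini_tonelli_F _ _ (measurableTypeR R)
    (measurableTypeR R) R leb F' mF' F'0).
- by move=> s _; apply: integral_ge0 => T _; exact: (F'0 (s, T)).
- by rewrite lee_fin ltW.
apply: eq_integral => s _; rewrite -ge0_integralZl//; last 3 first.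
- exact: (measurable_fun_pair2 s mF').
- by move=> T _; exact: (F'0 (s, T)).
- by rewrite lee_fin ltW.
apply: eq_integral => T _; rewrite -EFinM addrK /split_integrand /=.
by congr EFin; ring.
Qed.

End saddle_density.

Section saddle_law_monotone.
Context {R : realType}.
Local Notation leb := (@lebesgue_measure R).
Variable k : R -> R.
Local Open Scope ereal_scope.

Let mindic (D : set (R * R)) : measurable D -> measurable_fun setT (\1_D : R * R -> R).
Proof. by move=> mD; exact: measurable_indic. Qed.

Let indic0 (D : set (R * R)) z : (0 <= \1_D z :> R)%R.
Proof. by rewrite indicE. Qed.

Lemma split_integral_le (l l' : R) (G G' : R * R -> R) :
  measurable_fun setT G -> measurable_fun setT G' ->
  (forall z, 0 <= G z)%R -> (forall z, 0 <= G' z)%R ->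
  (forall s T, (0 < T)%R ->
    (G (left_root (s + drift k * l) T, right_root (s + drift k * l) T)
     <= G' (left_root (s + drift k * l') T, right_root (s + drift k * l') T))%R) ->
  split_integral k l G <= split_integral k l' G'.
Proof.
move=> mG mG' G0 G'0 GG'.
have m1 := measurable_split_integrand k mG l.
have m2 := measurable_split_integrand k mG' l'.
have p1 z : 0 <= (split_integrand k l G z)%:E.
  by rewrite lee_fin split_integrand_ge0.
have p2 z : 0 <= (split_integrand k l' G' z)%:E.
  by rewrite lee_fin split_integrand_ge0.
apply: ge0_le_integral => //.
- by move=> s _; apply: integral_ge0 => T _; exact: p1.
- exact: (@measurable_fun_fubini_tonelli_F _ _ (measurableTypeR R)
    (measurableTypeR R) R leb _ m1 p1).
- exact: (@measurable_fun_fubini_tonelli_F _ _ (measurableTypeR R)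
    (measurableTypeR R) R leb _ m2 p2).
- move=> s _.
  have m1s := measurable_fun_pair2 s m1; have m2s := measurable_fun_pair2 s m2.
  apply: ge0_le_integral => //.
  + move=> T _; rewrite lee_fin /split_integrand /=.
    have [T0|T0] := ltP 0%R T; last by rewrite /product_weight ltNge T0 /= mulr0 !mul0r.
    apply: ler_wpM2l; last exact: GG'.
    by rewrite mulr_ge0 ?sum_weight_ge0 ?product_weight_ge0.
Qed.

(** Two constants which normalise the same mass [W] agree. *)
Lemma normalised_le (c c' e e' : R) (W I I' : \bar R) : 0 <= W ->
  c%:E * (e%:E * W) = 1 -> c'%:E * (e'%:E * W) = 1 -> I <= I' ->
  c%:E * (e%:E * I) <= c'%:E * (e'%:E * I').
Proof.
rewrite !muleA -!EFinM; move: (c * e)%R (c' * e')%R => r r'.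
case: W => [w|_|//]; last first.
  move=> + _ _; rewrite mulry => /eqP.
  by case: sgrP; rewrite ?mul0e ?mul1e ?mulN1e//= eqe eq_sym oner_eq0.
rewrite lee_fin => w0; rewrite -!EFinM => -[ew] [e'w] II'.
have wn0 : w != 0%R by apply/eqP => w00; move/eqP: ew; rewrite w00 mulr0 eq_sym oner_eq0.
have -> : r = w^-1%R by rewrite -[LHS](mulfK wn0) ew mul1r.
have -> : r' = w^-1%R by rewrite -[LHS](mulfK wn0) e'w mul1r.
by rewrite lee_wpmul2l// lee_fin invr_ge0.
Qed.

(** The law with density proportional to [q k l] decreases stochastically with
    the level, tested on lower sets. *)
Lemma saddle_law_mono (l l' c c' : R) (D D' : set (R * R)) :
  measurable D -> measurable D' -> (l <= l')%R -> (drift k <= 0)%R -> D `<=` D' ->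
  (forall x y x' y' : R, (x' <= x)%R -> (y' <= y)%R -> D (x, y) -> D (x', y')) ->
  c%:E * \int[leb \x leb]_z (q k l z.1 z.2)%:E = 1 ->
  c'%:E * \int[leb \x leb]_z (q k l' z.1 z.2)%:E = 1 ->
  c%:E * \int[leb \x leb]_(z in D) (q k l z.1 z.2)%:E <=
  c'%:E * \int[leb \x leb]_(z in D') (q k l' z.1 z.2)%:E.
Proof.
move=> mD mD' ll' dr0 DD' lowD c1 c'1.
have JE a (B : set (R * R)) : measurable B ->
    \int[leb \x leb]_(z in B) (q k a z.1 z.2)%:E =
    (level_weight k a)%:E * split_integral k a \1_B.
  move=> mB; rewrite -(integral_q_shift k (mindic mB) (indic0 B)).
  rewrite integral_mkcond; apply: eq_integral => z _.
  by rewrite patchE indicE; case: ifP => _; rewrite ?mulr1 ?mulr0.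
(* The total mass does not depend on the level. *)
have totE a : split_integral k a \1_setT = split_integral k 0 \1_setT.
  apply: eq_integral => s _; apply: eq_integral => T _.
  by rewrite /split_integrand !indicT.
rewrite JE// totE in c1; rewrite JE// totE in c'1.
rewrite !JE//; apply: (normalised_le _ c1 c'1).
  apply: integral_ge0 => s _; apply: integral_ge0 => T _.
  by rewrite lee_fin split_integrand_ge0.
apply: split_integral_le => //; try exact: mindic.
move=> s T T0; rewrite !indicE ler_nat.
case: (boolP (_ \in D)) => //; rewrite inE => Dz.
rewrite mem_set//; apply: DD'; apply: lowD Dz.
- by apply: left_root_le; [exact: ltW|rewrite lerD2l ler_wnM2l].
- by apply: right_root_le; [exact: ltW|rewrite lerD2l ler_wnM2l].
Qed.

End saddle_law_monotone.

(** * Conditioning on an independent sigma-algebra *)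

Section joint_law.
Local Open Scope ereal_scope.
Context {R : realType} {d d1 d2 : measure_display}.
Context {Omega : measurableType d} {T1 : measurableType d1} {T2 : measurableType d2}.
Variable P : probability Omega R.

(** The joint law of independent variables is the product of their laws. *)
Lemma joint_law_independent (W : {RV P >-> T1}) (L : {RV P >-> T2})
    (E : set (T1 * T2)) :
  (forall A B, measurable A -> measurable B ->
    P (W @^-1` A `&` L @^-1` B) = P (W @^-1` A) * P (L @^-1` B)) ->
  measurable E ->
  P [set w | E (W w, L w)] = \int[P]_w P [set w' | E (W w, L w')].
Proof.
move=> ind mE.
have mWL : measurable_fun setT (fun w => (W w, L w)) by exact: measurable_fun_pair.
pose m' : {measure set (T1 * T2) -> \bar R} :=
  measure_function_pushforward__canonical__measure_function_Measure P mWL.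
transitivity (m' E); first by [].
rewrite -(@product_measure_unique _ _ _ _ _ (distribution P W) (distribution P L) m')//.
rewrite /product_measure1 ge0_integral_distribution//; last first.
  exact: measurable_fun_xsection.
apply: eq_integral => w _ /=; rewrite /distribution /pushforward; congr (P _).
by apply/seteqP; split => w' /=; rewrite /xsection /= inE.
Qed.

End joint_law.

Section freezing.
Local Open Scope ereal_scope.
Context {R : realType} {d d1 d2 : measure_display}.
Context {Omega : measurableType d} {T1 : measurableType d1} {T2 : measurableType d2}.
Variable P : probability Omega R.
Variable S : set_system Omega.
Hypothesis sS : sigma_algebra setT S.
Hypothesis mS : S `<=` measurable.
Variables (W : Omega -> T1) (L : {RV P >-> T2}).
Hypothesis SW : forall B, measurable B -> S (W @^-1` B).
Hypothesis ind : forall A C, S A -> measurable C ->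
  P (A `&` L @^-1` C) = P A * P (L @^-1` C).

(** When [L] is independent of the sigma-algebra [S] and [W] is measurable for
    [S], conditioning on [S] freezes [W]. *)
Lemma cond_prob_freeze (E : set (T1 * T2)) : measurable E ->
  is_cond_prob P S [set w | E (W w, L w)]
    (fun w => fine (P [set w' | E (W w, L w')])).
Proof.
move=> mE.
have mW : measurable_fun setT W.
  by move=> _ B mB; rewrite setTI; apply: mS; exact: SW.
pose phi (c : T1) : \bar R := P [set w' | E (c, L w')].
have phiE c : phi c = distribution P L (xsection E c).
  rewrite /phi /distribution /pushforward; congr (P _).
  by apply/seteqP; split => w' /=; rewrite /xsection /= inE.
have mphi : measurable_fun setT phi.
  by rewrite (funext phiE); exact: (measurable_fun_xsection (distribution P L)).
have mEc c : measurable [set w' | E (c, L w')].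
  rewrite (_ : [set _ | _] = L @^-1` (xsection E c)).
    rewrite -[X in measurable X]setTI.
    by apply: measurable_funP => //; exact: measurable_xsection.
  by apply/seteqP; split => w' /=; rewrite /xsection /= inE.
have phifin c : phi c \is a fin_num by exact: fin_num_measure.
split.
  move=> B mB.
  have -> : (fun w => fine (P [set w' | E (W w, L w')])) @^-1` B =
    W @^-1` ((fine \o phi) @^-1` B) by [].
  apply: SW; rewrite -[X in measurable X]setTI.
  have : measurable_fun setT (fine \o phi) by apply: measurableT_comp.
  exact.
move=> A SA.
have mA := mS SA.
(* The event A is carried along as an additional S-measurable variable. *)
pose W' w : T1 * R := (W w, \1_A w).
have mW' : measurable_fun setT W'.
  by apply: measurable_fun_pair => //; exact: measurable_indic.
pose W'rv : {RV P >-> (T1 * R)%type} :=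
  HB.pack W' (isMeasurableFun.Build _ _ _ _ W' mW').
have SI B C : S B -> S C -> S (B `&` C).
  move=> SB SC; have := @measurableI _ (g_sigma_algebraType S) B C.
  rewrite /measurable /= sigma_algebra_id//; exact.
have SW' B : measurable B -> S (W' @^-1` B).
  move=> mB.
  have -> : W' @^-1` B = (A `&` W @^-1` ((fun c => (c, 1%R)) @^-1` B)) `|`
     (~` A `&` W @^-1` ((fun c => (c, 0%R)) @^-1` B)).
    apply/seteqP; split => w; rewrite /W' /= indicE.
      by case: (boolP (w \in A)); rewrite ?inE ?notin_setE => Aw Bw; [left|right].
    by move=> [[Aw]|[Aw]]; [rewrite mem_set|rewrite memNset].
  have mpair (r : R) : S (W @^-1` ((fun c => (c, r)) @^-1` B)).
    apply: SW; rewrite -[X in measurable X]setTI.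
    by apply: (@pair2_measurable _ _ T1 R r).
  rewrite -[X in S X]setCK setCU; case: sS => _ SC _.
  have SCC X : S X -> S (~` X) by move=> SX; rewrite -setTD; exact: SC.
  by apply/SCC/SI; apply/SCC/SI => //; exact: SCC.
pose E' : set ((T1 * R) * T2) := [set z | E (z.1.1, z.2) /\ z.1.2 = 1%R].
have mE' : measurable E'.
  have -> : E' = ((fun z : (T1 * R) * T2 => (z.1.1, z.2)) @^-1` E) `&`
     ((fun z : (T1 * R) * T2 => z.1.2) @^-1` [set 1%R]) by [].
  apply: measurableI.
    rewrite -[X in measurable X]setTI.
    have : measurable_fun setT (fun z : (T1 * R) * T2 => (z.1.1, z.2)).
      by apply: measurable_fun_pair => //; exact: measurableT_comp.
    exact.
  rewrite -[X in measurable X]setTI.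
  have : measurable_fun setT (fun z : (T1 * R) * T2 => z.1.2) by exact: measurableT_comp.
  exact.
have indW' B C : measurable B -> measurable C ->
    P (W'rv @^-1` B `&` L @^-1` C) = P (W'rv @^-1` B) * P (L @^-1` C).
  by move=> mB mC; apply: ind => //; exact: SW'.
have := @joint_law_independent _ _ _ _ _ _ _ P W'rv L E' indW' mE'.
have -> : [set w | E' (W'rv w, L w)] = [set w | E (W w, L w)] `&` A.
  apply/seteqP; split => w; rewrite /E' /= indicE.
    move=> [Ew]; case: (boolP (w \in A)); first by rewrite inE.
    by move=> _ /esym/eqP; rewrite oner_eq0.
  by move=> [Ew Aw]; rewrite mem_set.
move=> ->.
rewrite [LHS]integral_mkcond; apply: eq_integral => w _.
rewrite patchE /E' /W'rv /=.
case: ifPn => [Aw|Aw].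
  rewrite fineK; last exact: phifin.
  congr (P _); apply/seteqP; split => w' /=; first by rewrite indicE Aw.
  by case.
rewrite (_ : [set _ | _] = set0) ?measure0//.
apply/seteqP; split => w' //= -[_].
by rewrite indicE (negbTE Aw) => /esym/eqP; rewrite oner_eq0.
Qed.

End freezing.

Section independence.
Local Open Scope ereal_scope.
Context {R : realType} {d d2 : measure_display}.
Context {Omega : measurableType d} {T2 : measurableType d2}.
Variable P : probability Omega R.

(** By uniqueness of finite measures, the product formula extends from the
    intersections of an event of [S1] and an event of [S2], which form a
    pi-system, to the sigma-algebra they generate. *)
Lemma independent3_join (S1 S2 : set_system Omega) (L : Omega -> T2) :
  sigma_algebra setT S1 -> sigma_algebra setT S2 ->
  S1 `<=` measurable -> S2 `<=` measurable -> measurable_fun setT L ->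
  independent3 P S1 S2 (preimage_set_system setT L measurable) ->
  forall A C, <<s S1 `|` S2 >> A -> measurable C ->
    P (A `&` L @^-1` C) = P A * P (L @^-1` C).
Proof.
move=> sS1 sS2 mS1 mS2 mL ind A C SA mC.
pose G : set_system Omega :=
  [set B | exists B1 B2, [/\ S1 B1, S2 B2 & B = B1 `&` B2]].
have S1T : S1 setT by case: sS1 => h0 hC _; rewrite -(setD0 setT); exact: hC.
have S2T : S2 setT by case: sS2 => h0 hC _; rewrite -(setD0 setT); exact: hC.
have SI (S : set_system Omega) B D : sigma_algebra setT S -> S B -> S D -> S (B `&` D).
  move=> sS SB SD; have := @measurableI _ (g_sigma_algebraType S) B D.
  rewrite /measurable /= sigma_algebra_id//; exact.
have GA : <<s G >> A.
  move: A SA; apply: smallest_sub; first exact: smallest_sigma_algebra.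
  move=> B [SB|SB]; apply: sub_sigma_algebra.
    by exists B, setT; rewrite setIT.
  by exists setT, B; rewrite setTI.
have mLC : measurable (L @^-1` C) by rewrite -[X in measurable X]setTI; exact: mL.
have PC0 : (0 <= fine (P (L @^-1` C)))%R by rewrite fine_ge0.
pose m1 : {measure set Omega -> \bar R} := mrestr P mLC.
pose m2 : {measure set Omega -> \bar R} := mscale (NngNum PC0) P.
have m2E B : m2 B = P B * P (L @^-1` C).
  by rewrite /m2 /= /mscale /= fineK ?fin_num_measure// muleC.
suff : m1 A = m2 A by rewrite m2E.
apply: (@g_sigma_algebra_measure_unique _ R Omega G _ (fun=> setT) _ _ m1 m2) => //.
- move=> _ [B1 [B2 [SB1 SB2 ->]]]; apply: measurableI; [exact: mS1|exact: mS2].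
- by move=> _; exists setT, setT; rewrite setIT.
- by rewrite bigcup_const//; exists 0%N.
- move=> _ _ [B1 [B2 [SB1 SB2 ->]]] [D1 [D2 [SD1 SD2 ->]]].
  exists (B1 `&` D1), (B2 `&` D2); split; [exact: SI|exact: SI|].
  by rewrite setIACA.
- move=> _ [B1 [B2 [SB1 SB2 ->]]]; rewrite m2E /m1 /= /mrestr.
  have SC : preimage_set_system setT L measurable (L @^-1` C).
    by exists C => //; rewrite setTI.
  have S3T : preimage_set_system setT L measurable setT.
    by exists setT => //; rewrite preimage_setT setIT.
  rewrite (ind _ _ _ SB1 SB2 SC); have := ind _ _ _ SB1 SB2 S3T.
  by rewrite setIT probability_setT mule1 => ->.
- by move=> n; rewrite /m1 /= /mrestr setTI -ge0_fin_numE ?fin_num_measure.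
Qed.

End independence.

(** * The conditional distribution function of the field *)

Section below_set.
Context {R : realType}.
Variables (alpha b11 b22 b12 : R * R -> R) (n : nat) (t : 'I_n -> R * R) (u : 'I_n -> R).

(** The constraints on the conditioned field, as a set of values of the fields
    g at the points [t i], of theta and of (lambda1, lambda2). *)
Definition below_set (l : R) : set ((n.-tuple R * R) * (R * R)) :=
  [set z | forall i, tnth z.1.1 i + l * alpha (t i)
     + z.2.1 * b1 b11 b22 b12 (t i) z.1.2 + z.2.2 * b2 b11 b22 b12 (t i) z.1.2 - l <= u i].

Lemma measurable_below_set l : measurable (below_set l).
Proof.
have mx : measurable_fun setT (fun z : (n.-tuple R * R) * (R * R) => z.2.1).
  exact: measurableT_comp.
have my : measurable_fun setT (fun z : (n.-tuple R * R) * (R * R) => z.2.2).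
  exact: measurableT_comp.
have mth : measurable_fun setT (fun z : (n.-tuple R * R) * (R * R) => z.1.2).
  exact: measurableT_comp.
have mc : measurable_fun setT (fun z : (n.-tuple R * R) * (R * R) => cos z.1.2).
  apply: (@measurableT_comp _ _ _ _ _ _ (@cos R)) => //.
  by apply: continuous_measurable_fun; exact: continuous_cos.
have ms : measurable_fun setT (fun z : (n.-tuple R * R) * (R * R) => sin z.1.2).
  apply: (@measurableT_comp _ _ _ _ _ _ (@sin R)) => //.
  by apply: continuous_measurable_fun; exact: continuous_sin.
have mt i : measurable_fun setT (fun z : (n.-tuple R * R) * (R * R) => tnth z.1.1 i).
  apply: (@measurableT_comp _ _ _ _ _ _ (fun c : n.-tuple R => tnth c i)).
    exact: measurable_tnth.
  exact: measurableT_comp.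
have mcst (a : R) : measurable_fun setT (fun _ : (n.-tuple R * R) * (R * R) => a).
  exact: measurable_cst.
pose F i (z : (n.-tuple R * R) * (R * R)) := tnth z.1.1 i + l * alpha (t i)
     + z.2.1 * b1 b11 b22 b12 (t i) z.1.2 + z.2.2 * b2 b11 b22 b12 (t i) z.1.2 - l.
have mF i : measurable_fun setT (F i).
  apply: measurable_funB => //; apply: measurable_funD.
    apply: measurable_funD; first exact: measurable_funD.
    apply: measurable_funM => //; apply: measurable_funD.
      by apply: measurable_funD; apply: measurable_funM => //; exact: measurable_funX.
    by apply: measurable_funM => //; exact: measurable_funM.
  apply: measurable_funM => //; apply: measurable_funB.
    by apply: measurable_funD; apply: measurable_funM => //; exact: measurable_funX.
  by apply: measurable_funM => //; exact: measurable_funM.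
have -> : below_set l = \bigcap_(i in [set: 'I_n]) (F i @^-1` `]-oo, u i]).
  apply/seteqP; split => z /=.
    by move=> zu i _; rewrite /= in_itv /=; exact: zu.
  by move=> zu i; have := zu i I; rewrite /= in_itv.
apply: fin_bigcap_measurable => [|i _]; first exact: finite_finset.
by rewrite -[X in measurable X]setTI; exact: mF.
Qed.

End below_set.

Unset Implicit Arguments.
Set Strict Implicit.

Theorem lemma5p7 (R : realType) (d d' : measure_display)
    (Omega : measurableType d) (P : probability Omega R)
    (f : R * R -> {RV P >-> R}) (k : R -> R)
    (hf : basic_assumption f) (hgrad : nondegenerate_gradient f)
    (hmono : monotonicity f k)
    (alpha b11 b22 b12 : R * R -> R)
    (hab : cond_mean_coefs f alpha b11 b22 b12)
    (Omega' : measurableType d') (P' : probability Omega' R)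
    (g : R * R -> {RV P' >-> R}) (theta : {RV P' >-> R})
    (lam1 lam2 : R -> {RV P' >-> R})
    (hrep : saddle_representation f k g theta lam1 lam2)
    (n : nat) (t : 'I_n -> R * R) (u : 'I_n -> R) :
  let below (l : R) (gr : R * R -> R) (th x y : R) : Prop :=
    forall i : 'I_n, ftilde alpha b11 b22 b12 l gr th x y (t i) - l <= u i in
  (* conditional probability given the realisation (gr, th) of (g, theta) *)
  let p (l : R) (gr : R * R -> R) (th : R) : R :=
    fine (P' [set w | below l gr th (lam1 l w) (lam2 l w)]) in
  (forall l : R,
     is_cond_prob P'
       (<<s sigma_of g `|` sigma_of (fun _ : unit => theta) >>)
       [set w | below l (fun s => g s w) (theta w) (lam1 l w) (lam2 l w)]
       (fun w => p l (fun s => g s w) (theta w)))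
  /\
  (forall (gr : R * R -> R) (th l l' : R),
     l <= l' -> p l gr th <= p l' gr th).
Proof.
move=> below p.
pose E l := below_set alpha b11 b22 b12 t u l.
have mE l : measurable (E l) by exact: measurable_below_set.
have belowE l gr th x y : below l gr th x y <->
    E l (([tuple gr (t i) | i < n], th), (x, y)).
  by split=> H i; have := H i; rewrite /ftilde /= tnth_mktuple.
have mL l : measurable_fun setT (fun w => (lam1 l w, lam2 l w)).
  by apply: measurable_fun_pair; exact: measurable_funP.
split=> [l|gr th l l' ll'].
  pose L : {RV P' >-> (R * R)%type} :=
    HB.pack (fun w => (lam1 l w, lam2 l w))
      (isMeasurableFun.Build _ _ _ _ _ (mL l)).
  pose W w := ([tuple g (t i) w | i < n], theta w).
  set S := <<s _ >>.
  have Sg : sigma_algebra setT (sigma_of g) by exact: smallest_sigma_algebra.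
  have Sth : sigma_algebra setT (sigma_of (fun _ : unit => theta)).
    exact: smallest_sigma_algebra.
  have mg : sigma_of g `<=` measurable.
    by move=> A; apply: sigma_of_measurable => i; exact: measurable_funP.
  have mth : sigma_of (fun _ : unit => theta) `<=` measurable.
    by move=> A; apply: sigma_of_measurable => i; exact: measurable_funP.
  have mS : S `<=` measurable.
    apply: smallest_sub; first exact: sigma_algebra_measurable.
    by move=> A [/mg|/mth].
  have SW B : measurable B -> S (W @^-1` B).
    move=> mB.
    pose U := g_sigma_algebraType (sigma_of g `|` sigma_of (fun _ : unit => theta)).
    have : measurable_fun [set: U] (W : U -> n.-tuple R * R).
      apply: measurable_fun_pair.
        apply/measurable_fun_tnthP => i _ C mC; rewrite setTI.
        apply: sub_sigma_algebra; left; apply: sub_sigma_algebra.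
        exists (t i) => //; exists C => //; rewrite setTI.
        by apply/seteqP; split => w /=; rewrite tnth_mktuple.
      move=> _ C mC; rewrite setTI.
      apply: sub_sigma_algebra; right; apply: sub_sigma_algebra.
      by exists tt => //; exists C => //; rewrite setTI.
    by move=> /(_ measurableT B mB); rewrite setTI.
  have ind := independent3_join Sg Sth mg mth (mL l) (rep_indep hrep (l := l)).
  have := @cond_prob_freeze _ _ _ _ _ _ _ P' S (smallest_sigma_algebra _ _) mS
    W L SW ind (E l) (mE l).
  have EW w w' : E l (W w, L w') <->
      below l (fun s => g s w) (theta w) (lam1 l w') (lam2 l w').
    apply: iff_sym.
    exact: (belowE l (fun s => g s w) (theta w) (lam1 l w') (lam2 l w')).
  have -> : [set w | E l (W w, L w)] =
      [set w | below l (fun s => g s w) (theta w) (lam1 l w) (lam2 l w)].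
    by apply/seteqP; split => w Ew; apply/(EW w w).
  have -> // : (fun w => fine (P' [set w' | E l (W w, L w')])) =
      (fun w => p l (fun s => g s w) (theta w)).
  apply/funext => w; congr (fine (P' _)).
  by apply/seteqP; split => w' Ew; apply/(EW w w').
(* The set of eigenvalues which satisfy the constraints. It grows with the level
   because alpha <= 1, and it is a lower set because b1 and b2 are nonnegative. *)
pose D l := xsection (E l) ([tuple gr (t i) | i < n], th).
have mD a : measurable (D a) by exact: measurable_xsection.
have DE a x y : D a (x, y) <-> below a gr th x y.
  by rewrite /D /xsection /= inE; apply: iff_sym; exact: belowE.
have pE a : [set w | below a gr th (lam1 a w) (lam2 a w)] =
    [set w | D a (lam1 a w, lam2 a w)].
  by apply/seteqP; split => w Dw; apply/DE.
have mpre a : measurable [set w | D a (lam1 a w, lam2 a w)].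
  by rewrite -[X in measurable X]setTI; exact: mL.
rewrite /p !pE; apply: fine_le; try exact: fin_num_measure.
have [c Hc] := rep_lambda hrep l; have [c' Hc'] := rep_lambda hrep l'.
rewrite Hc// Hc'//.
apply: saddle_law_mono => //.
- exact: drift_le0 hf hmono.
- move=> [x y] /DE xy; apply/DE => i; have := xy i.
  rewrite /ftilde; have := alpha_le1 (t i) hmono hab => a1.
  have : 0 <= (l' - l) * (1 - alpha (t i)) by rewrite mulr_ge0 ?subr_ge0.
  by lra.
- move=> x y x' y' x'x y'y /DE xy; apply/DE => i; have := xy i.
  rewrite /ftilde.
  have h1 := ler_wpM2r (b1_ge0 hf (mono_isotropic hmono) (t i) th hmono hab) x'x.
  have h2 := ler_wpM2r (b2_ge0 hf (mono_isotropic hmono) (t i) th hmono hab) y'y.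
  by lra.
- by rewrite -Hc// [X in P' X](_ : _ = setT) ?probability_setT//; apply/seteqP.
- by rewrite -Hc'// [X in P' X](_ : _ = setT) ?probability_setT//; apply/seteqP.
Qed.
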